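(* Let $\omega\in\mathbb{R}\setminus\mathbb{Q}$. Any $F\in\mathscr F_\omega$ admits a unique $F$-invariant formal foliation $\mathcal F_F\in\mathscr G\backslash\mathscr L$; it satisfies $\mathcal F_F=[L]$ for any $F$-admissible $L$, and $\mathcal F_F=[\nu]\circ\Phi$ for any formal geometric normalization $\Phi$ of $F$. Moreover, the invariant formal foliation is intrinsic: for any formal local change of coordinates $\Psi\in\mathscr F$, $$\mathcal F_{\Psi^{-1}\circ F\circ\Psi}=\mathcal F_F\circ\Psi .$$ In particular, if $\mathcal F_F$ is analytic, then so is $\mathcal F_{\Psi^{-1}\circ F\circ\Psi}$ for any analytic $\Psi\in\mathscr F$.
   Context: $\mathbb{R}^2\cong\mathbb{C}$, $\lambda=e^{2\pi i\omega}$. $\mathscr F$ is the group of formal diffeomorphisms of $(\mathbb{R}^2,0)$ whose linear part is a rotation, i.e. formal series $F(z)=\mu z+\sum_{j+k\ge2}F_{jk}z^j\bar z^k$ with $|\mu|=1$, $F_{jk}\in\mathbb{C}$; $\mathscr F_\omega\subset\mathscr F$ is the subset where $\mu=\lambda$. Here $z,\bar z$ are independent indeterminates, $\overline F$ is obtained by conjugating coefficients and exchanging $z$ and $\bar z$, and right composition with $F$ means substituting $(z,\bar z)\mapsto(F,\overline F)$. $\nu(z)=z\bar z$. $\mathscr L$ is the set of formal series $L(z)=z\bar z+\sum_{r+s\ge3}L_{rs}z^r\bar z^s$ with $L_{rs}=\overline{L_{sr}}\in\mathbb{C}$. $\mathscr G$ is the group (under composition) of formal series $R+\sum_{n\ge2}\Gamma_nR^n$,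 $\Gamma_n\in\mathbb{R}$; it acts on the left on $\mathscr L$ by $(g,L)\mapsto g\circ L$. A formal foliation is an element of $\mathscr G\backslash\mathscr L$, and $[L]=\{g\circ L: g\in\mathscr G\}$ is the class of $L$. It is analytic if at least one of its representatives is convergent, where $\sum a_{jk}z^j\bar z^k$ is convergent if $\sum|a_{jk}|\rho_1^j\rho_2^k<\infty$ for some $\rho_1,\rho_2>0$. For $F\in\mathscr F$, $[L]\circ F:=[L\circ F]$; $[L]$ is $F$-invariant if $[L]\circ F=[L]$. $L\in\mathscr L$ is $F$-admissible if there is $\Gamma\in\mathscr G$ with $L\circ F=\Gamma\circ L$. A formal geometric normalization of $F\in\mathscr F_\omega$ is a formal tangent-to-identity diffeomorphism $\Phi(z)=z+\sum_{j+k\ge2}\phi_{jk}z^j\bar z^k$ such that $G=\Phi\circ F\circ\Phi^{-1}$ satisfies $\nu\circ G=\Gamma\circ\nu$ for some $\Gamma\in\mathscr G$. *)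

(* Defs.v *)
(* MathComp-Analysis, with the complex numbers R[i] of mathcomp-real-closed. *)
From HB Require Import structures.
From mathcomp Require Export all_boot all_order all_algebra.
From mathcomp Require Export all_classical all_reals all_analysis.
From mathcomp Require Export complex.
Set Implicit Arguments.
Unset Strict Implicit.
Unset Printing Implicit Defensive.
Import Order.TTheory GRing.Theory Num.Theory.
Local Open Scope classical_set_scope.
Local Open Scope ring_scope.
Local Open Scope complex_scope.

Section FormalSeries.
Context {R : realType}.

(* [A j k] is the coefficient of z^j zbar^k, where z and zbar are independent
   indeterminates. *)
Definition series2 := nat -> nat -> R[i].

Definition mono2 (p q : nat) : series2 :=
  fun j k => ((j == p) && (k == q))%:R.

Definition mul2 (A B : series2) : series2 := fun j k =>
  \sum_(p < j.+1) \sum_(q < k.+1) A p q * B (j - p)%N (k - q)%N.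

Definition exp2 (A : series2) (n : nat) : series2 :=
  iter n (mul2 A) (mono2 0 0).

(* Coefficients are conjugated and z, zbar are exchanged. *)
Definition bar2 (A : series2) : series2 := fun j k => (A k j)^*.

(* Substitution (z, zbar) |-> (F, bar F) in A. It is meaningful when
   F 0 0 = 0: then F^p (bar F)^q has no term of total degree < p + q, so the
   finite sum below contains every nonzero contribution to degree j + k. *)
Definition comp2 (A F : series2) : series2 := fun j k =>
  \sum_(p < (j + k).+1) \sum_(q < (j + k).+1)
    A p q * mul2 (exp2 F p) (exp2 (bar2 F) q) j k.

(* g o L for a real series g = sum_n g_n X^n in one indeterminate. As for
   [comp2], it is meaningful when L 0 0 = 0. *)
Definition comp1 (g : nat -> R) (L : series2) : series2 := fun j k =>
  \sum_(n < (j + k).+1) (g n)%:C * exp2 L n j k.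

Definition convergent2 (A : series2) : Prop :=
  exists rho1 rho2 : R, [/\ 0 < rho1, 0 < rho2 &
    (\esum_(jk in [set: nat * nat])
       (Normc.normc (A jk.1 jk.2) * rho1 ^+ jk.1 * rho2 ^+ jk.2)%:E < +oo)%E].

Definition id2 : series2 := mono2 1 0.

Definition nu : series2 := mono2 1 1.

(* The linear part of F is z |-> mu z. *)
Definition has_linear_part (mu : R[i]) (F : series2) : Prop :=
  [/\ F 0%N 0%N = 0, F 1%N 0%N = mu & F 0%N 1%N = 0].

Definition expi2pi (omega : R) : R[i] :=
  cos (2 * pi * omega) +i* sin (2 * pi * omega).

Definition setF : set series2 :=
  [set F | exists2 mu : R[i], `|mu| = 1 & has_linear_part mu F].

Definition setF_rot (omega : R) : set series2 :=
  [set F | has_linear_part (expi2pi omega) F].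

Definition tangent_to_id (Phi : series2) : Prop := has_linear_part 1 Phi.

Definition setL : set series2 :=
  [set L | (forall j k, (j + k <= 2)%N -> L j k = nu j k) /\
           (forall r s, L r s = (L s r)^*)].

Definition setG : set (nat -> R) := [set g | g 0%N = 0 /\ g 1%N = 1].

(* The inverse for composition in the group [setF]. *)
Definition inv2 (F : series2) : series2 :=
  xget id2 [set F' | [/\ setF F', comp2 F F' = id2 & comp2 F' F = id2]].

(* The class [L] of L under the left action of [setG]. *)
Definition fclass (L : series2) : set series2 :=
  [set L' | exists2 g, setG g & L' = comp1 g L].

Definition formal_foliation (c : set series2) : Prop :=
  exists2 L, setL L & c = fclass L.

(* [L] o F := [L o F]; all the representatives L of a foliation c give the
   same class, which is therefore the union below. *)
Definition foliation_comp (c : set series2) (F : series2) : set series2 :=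
  \bigcup_(L in c) fclass (comp2 L F).

Definition foliation_invariant (F : series2) (c : set series2) : Prop :=
  foliation_comp c F = c.

Definition analytic_foliation (c : set series2) : Prop :=
  exists2 L, c L & convergent2 L.

(* The invariant foliation of F; it is meant to be used when it exists and is
   unique. *)
Definition invariant_foliation (F : series2) : set series2 :=
  xget set0 [set c | formal_foliation c /\ foliation_invariant F c].

Definition admissible (F L : series2) : Prop :=
  setL L /\ exists2 g, setG g & comp2 L F = comp1 g L.

Definition geometric_normalization (F Phi : series2) : Prop :=
  tangent_to_id Phi /\
  let G := comp2 Phi (comp2 F (inv2 Phi)) in
  exists2 g, setG g & comp2 nu G = comp1 g nu.

Definition conj2 (Psi F : series2) : series2 :=
  comp2 (inv2 Psi) (comp2 F Psi).

End FormalSeries.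

Arguments series2 R : clear implicits.

(* Main.v *)
From HB Require Import structures.
Require Import Defs.
From mathcomp Require Import zify ring lra.

(** The class [L] is F-invariant exactly when L is F-admissible, i.e. when
L o F = g o L for some real series g(x) = x + ... in one variable, called a
transition series below. So the theorem is about the solutions (L, g) of this
conjugacy equation.

Write lambda for the multiplier of F, which is not a root of unity. In degree
n = r + s >= 3, the coefficient of z^r zbar^s in L o F - g o L depends on the
coefficients of L and g in degree n (where g_r counts as degree 2r) only
through the term (lambda^r conj(lambda)^s - 1) L_rs - g_r, the last summand
being present only if r = s. For r <> s the factor in front of L_rs does not
vanish; for r = s it vanishes, but there the equation determines g_r instead.
Hence, once the diagonal coefficients L_rr are chosen, the equation is a
triangular system with nonzero pivots whose unknown is one series M, holding
L_rs off the diagonal and g_r on it. It has exactly one solution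
([triangular_solution], [triangular_uniq]); when the chosen diagonal is real,
the solution is real as well, because conjugation permutes the solutions.
A zero diagonal gives existence ([admissible_exists]).

For uniqueness, the diagonal of g o L can be prescribed at will by the choice
of g, which is again a triangular system ([adjust_diagonal]). Given two
admissible series L and L', pick g such that g o L has the same diagonal as
L'. Both are admissible, so they coincide ([admissible_orbit]): [L] = [L'].

The other claims follow formally. If Phi normalizes F, then nu o Phi is
F-admissible; if L is F-admissible, then L o Psi is admissible for
Psi^-1 o F o Psi. Analyticity is preserved because convergent series can be
composed ([convergent2_comp2]): a truncated weighted l1 norm is
submultiplicative, and for a series without constant term it becomes as small
as desired when the radius shrinks.

The calculus of substitutions is derived from one principle: two linear maps
which respect the order of vanishing and agree on monomials are equal
([continuous_linear_eq]). *)

Set Implicit Arguments.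
Unset Strict Implicit.
Unset Printing Implicit Defensive.
Import Order.TTheory GRing.Theory Num.Theory.
Local Open Scope classical_set_scope.
Local Open Scope ring_scope.
Local Open Scope complex_scope.

(** * The algebra of formal series in two indeterminates *)

Section SeriesRing.
Context {R : realType}.
Implicit Types A B C : series2 R.

Definition add2 A B : series2 R := fun j k => A j k + B j k.
Definition opp2 A : series2 R := fun j k => - A j k.
Definition scale2 (a : R[i]) A : series2 R := fun j k => a * A j k.

Lemma eq_series2 A B : (forall j k, A j k = B j k) -> A = B.
Proof. by move=> AB; apply/funext => j; apply/funext => k. Qed.

(** Products of series agree, coefficient by coefficient, with products of
their polynomial truncations; the ring laws are inherited from polynomials. *)
Definition trunc2 n A : {poly {poly R[i]}} :=
  \poly_(j < n) \poly_(k < n) A j k.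

Lemma trunc2E n A j k : (j < n)%N -> (k < n)%N -> (trunc2 n A)`_j`_k = A j k.
Proof. by move=> jn kn; rewrite coef_poly jn coef_poly kn. Qed.

Lemma mul2_coef A B (P Q : {poly {poly R[i]}}) j k :
  (forall p q, (p <= j)%N -> (q <= k)%N -> P`_p`_q = A p q) ->
  (forall p q, (p <= j)%N -> (q <= k)%N -> Q`_p`_q = B p q) ->
  mul2 A B j k = (P * Q)`_j`_k.
Proof.
move=> PA QB; rewrite coefM coef_sum; apply: eq_bigr => p _.
rewrite coefM; apply: eq_bigr => q _.
by rewrite PA ?QB ?leq_subr// -ltnS.
Qed.

Lemma mul2_trunc n A B j k : (j < n)%N -> (k < n)%N ->
  mul2 A B j k = (trunc2 n A * trunc2 n B)`_j`_k.
Proof.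
by move=> jn kn; apply: mul2_coef => p q pj qk; rewrite trunc2E//; lia.
Qed.

Fact add2A : associative add2.
Proof. by move=> A B C; apply: eq_series2 => j k; exact: addrA. Qed.
Fact add2C : commutative add2.
Proof. by move=> A B; apply: eq_series2 => j k; exact: addrC. Qed.
Fact add20 : left_id (fun _ _ => 0 : R[i]) add2.
Proof. by move=> A; apply: eq_series2 => j k; exact: add0r. Qed.
Fact add2N : left_inverse (fun _ _ => 0 : R[i]) opp2 add2.
Proof. by move=> A; apply: eq_series2 => j k; exact: addNr. Qed.

Fact mul2A : associative (@mul2 R).
Proof.
move=> A B C; apply: eq_series2 => j k; pose n := (j + k).+1.
rewrite (@mul2_coef _ _ (trunc2 n A) (trunc2 n B * trunc2 n C)); first last.
- by move=> p q pj qk; rewrite -mul2_trunc//; lia.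
- by move=> p q pj qk; rewrite trunc2E//; lia.
rewrite (@mul2_coef _ _ (trunc2 n A * trunc2 n B) (trunc2 n C)) ?mulrA//.
- by move=> p q pj qk; rewrite -mul2_trunc//; lia.
- by move=> p q pj qk; rewrite trunc2E//; lia.
Qed.

Fact mul2C : commutative (@mul2 R).
Proof.
move=> A B; apply: eq_series2 => j k.
by rewrite !(@mul2_trunc (j + k).+1) 1?mulrC//; lia.
Qed.

Fact mul21 : left_id (mono2 0 0) (@mul2 R).
Proof.
move=> A; apply: eq_series2 => j k.
rewrite (@mul2_coef _ _ 1 (trunc2 (j + k).+1 A)) ?mul1r ?trunc2E//; try lia.
  by move=> p q _ _; rewrite coef1 /mono2; case: p => [|p]; rewrite ?coef1 ?coef0.
by move=> p q pj qk; rewrite trunc2E//; lia.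
Qed.

Fact mul2D : left_distributive (@mul2 R) add2.
Proof.
move=> A B C; apply: eq_series2 => j k.
rewrite /mul2 /add2 -big_split; apply: eq_bigr => p _.
by rewrite -big_split; apply: eq_bigr => q _; rewrite /= mulrDl.
Qed.

(** As a function type, a series has pointwise operations. The instances below
are attached to the name [series2] and have the Cauchy product as product. *)
HB.instance Definition _ := Choice.copy (series2 R) (nat -> nat -> R[i]).
HB.instance Definition _ :=
  GRing.isZmodule.Build (series2 R) add2A add2C add20 add2N.
Fact mono2_00_neq0 : mono2 0 0 != 0 :> series2 R.
Proof.
by apply/eqP => /(congr1 (fun A : series2 R => A 0%N 0%N))/eqP; rewrite oner_eq0.
Qed.
HB.instance Definition _ :=
  GRing.Zmodule_isComNzRing.Build (series2 R) mul2A mul2C mul21 mul2D mono2_00_neq0.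
Fact scale2A a b A : scale2 a (scale2 b A) = scale2 (a * b) A.
Proof. by apply: eq_series2 => j k; exact: mulrA. Qed.
Fact scale21 : left_id 1 scale2.
Proof. by move=> A; apply: eq_series2 => j k; exact: mul1r. Qed.
Fact scale2Dr : right_distributive scale2 +%R.
Proof. by move=> a A B; apply: eq_series2 => j k; exact: mulrDr. Qed.
Fact scale2Dl A : {morph scale2^~ A : a b / a + b}.
Proof. by move=> a b; apply: eq_series2 => j k; exact: mulrDl. Qed.
HB.instance Definition _ := GRing.Zmodule_isLmodule.Build R[i] (series2 R)
  scale2A scale21 scale2Dr scale2Dl.
Fact scale2Al a A B : a *: (A * B) = a *: A * B.
Proof.
apply: eq_series2 => j k; rewrite [LHS]mulr_sumr; apply: eq_bigr => p _.
by rewrite mulr_sumr; apply: eq_bigr => q _; rewrite mulrA.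
Qed.
HB.instance Definition _ :=
  GRing.Lmodule_isLalgebra.Build R[i] (series2 R) scale2Al.
HB.instance Definition _ :=
  GRing.Lalgebra_isComAlgebra.Build R[i] (series2 R).

Lemma add2E A B j k : (A + B) j k = A j k + B j k. Proof. by []. Qed.
Lemma opp2E A j k : (- A) j k = - A j k. Proof. by []. Qed.
Lemma scale2E a A j k : (a *: A) j k = a * A j k. Proof. by []. Qed.
Lemma one2E j k : (1 : series2 R) j k = ((j == 0%N) && (k == 0%N))%:R.
Proof. by []. Qed.
Lemma exp2E A n : exp2 A n = A ^+ n.
Proof. by elim: n => [//|n IH]; rewrite exprS -IH. Qed.
Lemma sum2E I (r : seq I) (P : pred I) (F : I -> series2 R) j k :
  (\sum_(i <- r | P i) F i) j k = \sum_(i <- r | P i) F i j k.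
Proof. by elim/big_rec2: _ => // i x A _ <-. Qed.
End SeriesRing.

(** * Order of vanishing and substitution *)

Section Vanishing.
Context {R : realType}.
Implicit Types A B C F G : series2 R.

(** A series vanishes to order n when it lies in the n-th power of the maximal
ideal. All limits below are taken in the corresponding adic topology, and
congruences modulo this ideal are written [vanish n (A - B)]. *)
Definition vanish n A := forall j k, (j + k < n)%N -> A j k = 0.

Lemma vanish_zero n : vanish n 0. Proof. by []. Qed.

Lemma vanishW m n A : (m <= n)%N -> vanish n A -> vanish m A.
Proof. by move=> mn An j k jk; apply: An; lia. Qed.

Lemma vanishD n A B : vanish n A -> vanish n B -> vanish n (A + B).
Proof. by move=> An Bn j k jk; rewrite add2E An// Bn// addr0. Qed.

Lemma vanishN n A : vanish n A -> vanish n (- A).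
Proof. by move=> An j k jk; rewrite opp2E An// oppr0. Qed.

Lemma vanishB n A B : vanish n A -> vanish n B -> vanish n (A - B).
Proof. by move=> An Bn; apply: vanishD => //; apply: vanishN. Qed.

Lemma vanishZ n a A : vanish n A -> vanish n (a *: A).
Proof. by move=> An j k jk; rewrite scale2E An// mulr0. Qed.

Lemma vanishM m n A B : vanish m A -> vanish n B -> vanish (m + n) (A * B).
Proof.
move=> Am Bn j k jk; apply: big1 => -[p /= pj] _; apply: big1 => -[q /= qk] _.
have [pq|pq] := ltnP (p + q) m; first by rewrite Am// mul0r.
by rewrite Bn ?mulr0//; lia.
Qed.

Lemma vanishX a A n : vanish a A -> vanish (a * n) (A ^+ n).
Proof.
move=> Aa; elim: n => [|n IH]; first by rewrite muln0.
by rewrite exprS mulnS; apply: vanishM.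
Qed.

Lemma vanishXX F G p q : vanish 1 F -> vanish 1 G ->
  vanish (p + q) (F ^+ p * G ^+ q).
Proof.
by move=> F1 G1; apply: vanishM; rewrite -[X in vanish X]mul1n; apply: vanishX.
Qed.

Lemma vanish_trans n A B C :
  vanish n (A - B) -> vanish n (B - C) -> vanish n (A - C).
Proof.
by move=> AB BC; rewrite -[A](subrK B) -addrA; apply: vanishD.
Qed.

Lemma vanish_sym n A B : vanish n (A - B) -> vanish n (B - A).
Proof. by move=> AB; rewrite -opprB; apply: vanishN. Qed.

Lemma vanish_eq A B : (forall n, vanish n (A - B)) -> A = B.
Proof.
move=> AB; apply: eq_series2 => j k; apply/eqP; rewrite -subr_eq0; apply/eqP.
exact: (AB (j + k).+1).
Qed.

Lemma vanish1 A : A 0%N 0%N = 0 -> vanish 1 A.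
Proof. by move=> A0 [|j] [|k]. Qed.

Lemma mono2M p q p' q' :
  mono2 p q * mono2 p' q' = mono2 (p + p') (q + q') :> series2 R.
Proof.
apply: eq_series2 => j k; rewrite [LHS]/GRing.mul/= /mul2.
have [/andP[pj qk]|pqjk] := boolP ((p <= j) && (q <= k))%N; last first.
  rewrite /mono2 [RHS](_ : _ = 0); last by case: eqP => //= ?; case: eqP => //=; lia.
  apply: big1 => -[a /= aj] _; apply: big1 => -[b /= bk] _.
  by rewrite (_ : _ && _ = false) ?mul0r//; lia.
rewrite (bigD1 (inord p))//= [X in _ + X]big1 ?addr0; last first.
  move=> [a /= aj]; rewrite -val_eqE/= inordK// => ap.
  by apply: big1 => b _; rewrite /mono2 (negPf ap) mul0r.
rewrite inordK// (bigD1 (inord q))//= [X in _ + X]big1 ?addr0; last first.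
  move=> [a /= aj]; rewrite -val_eqE/= inordK// => aq.
  by rewrite /mono2 (negPf aq) andbF mul0r.
rewrite inordK// /mono2 !eqxx mul1r.
by congr ((nat_of_bool _)%:R); lia.
Qed.

Lemma mono2E p q : mono2 p q = mono2 1 0 ^+ p * mono2 0 1 ^+ q :> series2 R.
Proof.
have EX a b n : mono2 a b ^+ n = mono2 (a * n) (b * n) :> series2 R.
  elim: n => [|n IH]; first by rewrite !muln0.
  by rewrite exprS IH mono2M !mulnS.
by rewrite !EX mono2M !mul1n !mul0n addn0.
Qed.

Lemma vanish_mono2 p q : vanish (p + q) (mono2 p q : series2 R).
Proof. by move=> j k jk; rewrite /mono2; case: eqP => //= ?; case: eqP => //=; lia. Qed.

Lemma monomial_expansion n A :
  vanish n (A - \sum_(p < n) \sum_(q < n) A p q *: mono2 p q).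
Proof.
move=> j k jk; have [jn kn] : (j < n)%N /\ (k < n)%N by lia.
rewrite add2E opp2E sum2E (bigD1 (Ordinal jn))//= [X in _ - (_ + X)]big1 ?addr0; last first.
  move=> p; rewrite -val_eqE/= eq_sym => /negPf pj.
  by rewrite sum2E big1// => q _; rewrite scale2E /mono2 pj mulr0.
rewrite sum2E (bigD1 (Ordinal kn))//= [X in _ - (_ + X)]big1 ?addr0; last first.
  move=> q; rewrite -val_eqE/= eq_sym => /negPf qk.
  by rewrite scale2E /mono2 qk andbF mulr0.
by rewrite scale2E /mono2 !eqxx mulr1 subrr.
Qed.

(** The monomials span a dense subspace: the difference of the two maps kills
the degree-n truncation of A and sends the rest to order n, for every n. *)
Lemma continuous_linear_eq (phi psi : series2 R -> series2 R) :
  linear phi -> linear psi ->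
  (forall n A, vanish n A -> vanish n (phi A)) ->
  (forall n A, vanish n A -> vanish n (psi A)) ->
  (forall p q, phi (mono2 p q) = psi (mono2 p q)) ->
  phi =1 psi.
Proof.
move=> lphi lpsi cphi cpsi phipsi.
pose d A := phi A - psi A.
have dl a A B : d (a *: A + B) = a *: d A + d B.
  by rewrite /d lphi lpsi scalerBr opprD addrACA.
have d0 : d 0 = 0.
  by have := dl 1 0 0; rewrite !scale1r addr0 => /esym/eqP; rewrite -subr_eq0 addrK => /eqP.
have dZ a A : d (a *: A) = a *: d A by rewrite -[a *: A]addr0 dl d0 addr0.
have dD : {morph d : A B / A + B} by move=> A B; rewrite -[A in LHS]scale1r dl scale1r.
move=> A; apply: vanish_eq => n.
have dn : vanish n (d (A - \sum_(p < n) \sum_(q < n) A p q *: mono2 p q)).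
  by apply: vanishB; [apply: cphi|apply: cpsi]; apply: monomial_expansion.
have dS : d (\sum_(p < n) \sum_(q < n) A p q *: mono2 p q) = 0.
  rewrite (big_morph d dD d0) big1// => p _; rewrite (big_morph d dD d0) big1// => q _.
  by rewrite dZ /d phipsi subrr scaler0.
by move: dn; rewrite -scaleN1r addrC dl dS scaler0 add0r.
Qed.

End Vanishing.

Section Substitution.
Context {R : realType}.
Implicit Types A B C F G H K : series2 R.

(** Substitution of two unrelated series for z and zbar. Composition with a
diffeomorphism is the case G = bar F, and composition of a one-variable series
with L is the case where A depends on z alone; both inherit their laws from it. *)
Definition sub2 A F G : series2 R := fun j k =>
  \sum_(p < (j + k).+1) \sum_(q < (j + k).+1) A p q * (F ^+ p * G ^+ q) j k.

Lemma comp2E A F : comp2 A F = sub2 A F (bar2 F).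
Proof.
apply: eq_series2 => j k; apply: eq_bigr => p _; apply: eq_bigr => q _.
by rewrite !exp2E.
Qed.

(** The number of summands in a substituted coefficient depends on its degree.
This allows one common range of summation for all small degrees. *)
Lemma big_square_widen (V : zmodType) (m n : nat) (f : nat -> nat -> V) :
  (m <= n)%N -> (forall p q, (m <= p + q)%N -> f p q = 0) ->
  \sum_(p < m) \sum_(q < m) f p q = \sum_(p < n) \sum_(q < n) f p q.
Proof.
move=> mn f0; rewrite (big_ord_widen n (fun p => \sum_(q < m) f p q))//.
rewrite big_mkcond; apply: eq_bigr => p _; case: ltnP => pm; last first.
  by rewrite big1// => q _; apply: f0; lia.
rewrite (big_ord_widen n (f p))// big_mkcond; apply: eq_bigr => q _.
by case: ltnP => // qm; rewrite f0//; lia.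
Qed.

Lemma sub2_coef n A F G j k : vanish 1 F -> vanish 1 G -> (j + k < n)%N ->
  sub2 A F G j k = \sum_(p < n) \sum_(q < n) A p q * (F ^+ p * G ^+ q) j k.
Proof.
move=> F1 G1 jk.
apply: (big_square_widen (f := fun p q => A p q * (F ^+ p * G ^+ q) j k)) => // p q pq.
by rewrite (vanishXX F1 G1 pq) mulr0.
Qed.

Lemma sub2_linear F G : linear (fun A => sub2 A F G).
Proof.
move=> a A B; apply: eq_series2 => j k; rewrite add2E scale2E.
rewrite mulr_sumr -big_split; apply: eq_bigr => p _.
rewrite mulr_sumr -big_split; apply: eq_bigr => q _.
by rewrite /= mulrA -mulrDl.
Qed.

Lemma sub20 F G : sub2 0 F G = 0.
Proof.
by apply: eq_series2 => j k; apply: big1 => p _; apply: big1 => q _; rewrite mul0r.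
Qed.

Lemma sub2B A B F G : sub2 (A - B) F G = sub2 A F G - sub2 B F G.
Proof. by rewrite addrC -scaleN1r sub2_linear scaleN1r addrC. Qed.

Lemma vanish_sub2 n A F G : vanish 1 F -> vanish 1 G ->
  vanish n A -> vanish n (sub2 A F G).
Proof.
move=> F1 G1 An j k jk; apply: big1 => -[p /= pj] _; apply: big1 => -[q /= qj] _.
have [pq|pq] := ltnP (p + q) n; first by rewrite An// mul0r.
by rewrite (vanishXX F1 G1) ?mulr0//; lia.
Qed.

Lemma sub2_mono2 F G p q : vanish 1 F -> vanish 1 G ->
  sub2 (mono2 p q) F G = F ^+ p * G ^+ q.
Proof.
move=> F1 G1; apply: eq_series2 => j k.
have [pn qn] : (p < (j + k + p + q).+1)%N /\ (q < (j + k + p + q).+1)%N by lia.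
rewrite (@sub2_coef (j + k + p + q).+1)//; last by lia.
rewrite (bigD1 (Ordinal pn))//= [X in _ + X]big1 ?addr0; last first.
  move=> a; rewrite -val_eqE/= => /negPf ap.
  by rewrite big1// => b _; rewrite /mono2 ap mul0r.
rewrite (bigD1 (Ordinal qn))//= [X in _ + X]big1 ?addr0; last first.
  move=> b; rewrite -val_eqE/= => /negPf bq.
  by rewrite /mono2 bq andbF mul0r.
by rewrite /mono2 !eqxx mul1r.
Qed.

Lemma sub2_id A : sub2 A (mono2 1 0) (mono2 0 1) = A.
Proof.
have X1 : vanish 1 (mono2 1 0 : series2 R) by exact: vanish1.
have Y1 : vanish 1 (mono2 0 1 : series2 R) by exact: vanish1.
apply: (continuous_linear_eq (phi := fun A => sub2 A _ _) (psi := id)).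
- exact: sub2_linear.
- by [].
- by move=> n B; apply: vanish_sub2.
- by [].
- by move=> p q; rewrite sub2_mono2// -mono2E.
Qed.

(** Checked on monomials, for one factor at a time. *)
Lemma sub2M A B F G : vanish 1 F -> vanish 1 G ->
  sub2 (A * B) F G = sub2 A F G * sub2 B F G.
Proof.
move=> F1 G1.
have cs n C := @vanish_sub2 n C F G F1 G1.
have mulW n C D : vanish n C -> vanish n (C * D).
  by move=> Cn; rewrite -[n]addn0; apply: vanishM.
apply: (continuous_linear_eq (phi := fun A => sub2 (A * B) F G)
  (psi := fun A => sub2 A F G * sub2 B F G)).
- by move=> a C D; rewrite mulrDl -scalerAl sub2_linear.
- by move=> a C D; rewrite sub2_linear mulrDl -scalerAl.
- by move=> n C Cn; apply/cs/mulW.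
- by move=> n C Cn; apply/mulW/cs.
move=> p q.
apply: (continuous_linear_eq (phi := fun B => sub2 (mono2 p q * B) F G)
  (psi := fun B => sub2 (mono2 p q) F G * sub2 B F G)).
- by move=> a C D; rewrite mulrDr -scalerAr sub2_linear.
- by move=> a C D; rewrite sub2_linear mulrDr -scalerAr.
- by move=> n C Cn; rewrite mulrC; apply/cs/mulW.
- by move=> n C Cn; rewrite mulrC; apply/mulW/cs.
move=> p' q'; rewrite mono2M !sub2_mono2// !exprD.
ring.
Qed.

Lemma sub2X A n F G : vanish 1 F -> vanish 1 G ->
  sub2 (A ^+ n) F G = sub2 A F G ^+ n.
Proof.
move=> F1 G1; elim: n => [|n IH].
  by rewrite !expr0 -[RHS]mulr1; exact: (@sub2_mono2 F G 0 0).
by rewrite !exprS sub2M// IH.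
Qed.

Lemma sub2A A F G H K :
  vanish 1 F -> vanish 1 G -> vanish 1 H -> vanish 1 K ->
  sub2 (sub2 A F G) H K = sub2 A (sub2 F H K) (sub2 G H K).
Proof.
move=> F1 G1 H1 K1.
have FHK : vanish 1 (sub2 F H K) by exact: vanish_sub2.
have GHK : vanish 1 (sub2 G H K) by exact: vanish_sub2.
apply: (continuous_linear_eq (phi := fun A => sub2 (sub2 A F G) H K)
  (psi := fun A => sub2 A (sub2 F H K) (sub2 G H K))).
- by move=> a C D; rewrite !sub2_linear.
- exact: sub2_linear.
- by move=> n C Cn; do 2!apply: vanish_sub2 => //.
- by move=> n C Cn; apply: vanish_sub2.
by move=> p q; rewrite !sub2_mono2// sub2M// !sub2X.
Qed.

End Substitution.

(** * Leading terms of substitutions, conjugation *)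

Section LeadingTerms.
Context {R : realType}.
Implicit Types A B C F G H K L : series2 R.

(** Factor F ^ p - F' ^ p: each summand has one factor F - F' and p - 1 factors
vanishing to order a. *)
Lemma vanish_powD a b F F' p : (a <= b)%N -> vanish a F -> vanish a F' ->
  vanish b (F - F') -> vanish (b + a * p - a) (F ^+ p - F' ^+ p).
Proof.
move=> ab Fa F'a FF'.
elim: p => [|p IH]; first by rewrite !expr0 subrr; exact: vanish_zero.
rewrite !exprS (_ : _ - _ = (F - F') * F ^+ p + F' * (F ^+ p - F' ^+ p)); last by ring.
apply: vanishD.
  by apply: (@vanishW R _ (b + a * p)); [lia|apply: vanishM => //; apply: vanishX].
by apply: (@vanishW R _ (a + (b + a * p - a))); [lia|apply: vanishM].
Qed.

Lemma vanish_monoD b F F' G G' p q : (0 < b)%N ->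
  vanish 1 F -> vanish 1 F' -> vanish 1 G -> vanish 1 G' ->
  vanish b (F - F') -> vanish b (G - G') ->
  vanish (b + p + q).-1 (F ^+ p * G ^+ q - F' ^+ p * G' ^+ q).
Proof.
move=> b0 F1 F'1 G1 G'1 FF' GG'.
rewrite (_ : _ - _ = (F ^+ p - F' ^+ p) * G ^+ q + F' ^+ p * (G ^+ q - G' ^+ q)); last by ring.
apply: vanishD.
  apply: (@vanishW R _ (b + 1 * p - 1 + 1 * q)); first by lia.
  by apply: vanishM; [apply: vanish_powD|apply: vanishX].
apply: (@vanishW R _ (1 * p + (b + 1 * q - 1))); first by lia.
by apply: vanishM; [apply: vanishX|apply: vanish_powD].
Qed.

(** If A starts in degree n, an error of order b in the substituted series gets
multiplied by n - 1 further factors without constant term. *)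
Lemma vanish_sub2D b n A F F' G G' : (0 < b)%N ->
  vanish 1 F -> vanish 1 F' -> vanish 1 G -> vanish 1 G' ->
  vanish b (F - F') -> vanish b (G - G') -> vanish n A ->
  vanish (b + n).-1 (sub2 A F G - sub2 A F' G').
Proof.
move=> b0 F1 F'1 G1 G'1 FF' GG' An j k jk.
rewrite add2E opp2E /sub2 -sumrB big1// => p _; rewrite -sumrB big1// => q _.
have [pq|pq] := ltnP (p + q) n; first by rewrite An// !mul0r subrr.
rewrite -mulrBr; have := @vanish_monoD b F F' G G' p q b0 F1 F'1 G1 G'1 FF' GG' j k.
by rewrite add2E opp2E => ->; rewrite ?mulr0//; lia.
Qed.

Lemma sub2_coef00 A F G : sub2 A F G 0%N 0%N = A 0%N 0%N.
Proof. by rewrite /sub2 !big_ord1 !expr0 mulr1 one2E mulr1. Qed.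

Lemma sub2_lin A F G j k : vanish 1 F -> vanish 1 G -> (j + k = 1)%N ->
  sub2 A F G j k = A 1%N 0%N * F j k + A 0%N 1%N * G j k.
Proof.
move=> F1 G1 jk; rewrite (@sub2_coef _ 2)//; last by rewrite jk.
rewrite !big_ord_recl !big_ord0 /= !addr0 /bump/= !expr0 !expr1 !mulr1 !mul1r.
have -> : (1 : series2 R) j k = 0 by rewrite one2E; case: j jk => [|j]; case: k => [|k].
have -> : (F * G) j k = 0 by apply: (vanishM F1 G1); rewrite jk.
by rewrite !mulr0 add0r addr0 addrC.
Qed.

(** Perturbing the substituted series in order n changes the result, in degree
n, only through the linear part of A; the quadratic part of A contributes in
degree n + 1 and beyond. *)
Lemma sub2_diff n A F F' G G' : (0 < n)%N ->
  vanish 1 F -> vanish 1 F' -> vanish 1 G -> vanish 1 G' ->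
  vanish n (F - F') -> vanish n (G - G') ->
  vanish n.+1 (sub2 A F G - sub2 A F' G'
    - (A 1%N 0%N *: (F - F') + A 0%N 1%N *: (G - G'))).
Proof.
move=> n0 F1 F'1 G1 G'1 FF' GG'.
(* The affine part of A; the rest starts in degree 2. *)
pose A1 := A 0%N 0%N *: mono2 0 0 + (A 1%N 0%N *: mono2 1 0 + A 0%N 1%N *: mono2 0 1).
have A1E F0 G0 : vanish 1 F0 -> vanish 1 G0 ->
    sub2 A1 F0 G0 = A 0%N 0%N *: 1 + (A 1%N 0%N *: F0 + A 0%N 1%N *: G0).
  move=> F01 G01; rewrite /A1 sub2_linear sub2_mono2// sub2_linear sub2_mono2//.
  rewrite -[A 0%N 1%N *: mono2 0 1]addr0 sub2_linear sub2_mono2//.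
  rewrite sub20.
  by rewrite !expr0 !expr1 !mul1r mulr1 addr0.
have A2 : vanish 2 (A - A1).
  move=> j k; rewrite add2E opp2E /A1 !add2E !scale2E /mono2.
  by case: j => [|[|j]]; case: k => [|[|k]]//= _;
    rewrite ?mulr1 ?mulr0 ?addr0 ?add0r ?subrr.
have := @vanish_sub2D n 2 (A - A1) F F' G G' n0 F1 F'1 G1 G'1 FF' GG' A2.
rewrite !sub2B !A1E// addn2/=.
set a := sub2 A F G; set b := sub2 A F' G'; congr (vanish _ _).
rewrite !scalerBr; set x := _ *: F; set y := _ *: G; set x' := _ *: F'; set y' := _ *: G'.
ring.
Qed.

Lemma sub2_dilation mu1 mu2 A :
  sub2 A (mu1 *: mono2 1 0) (mu2 *: mono2 0 1)
    = (fun j k => mu1 ^+ j * mu2 ^+ k * A j k) :> series2 R.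
Proof.
have X1 : vanish 1 (mu1 *: mono2 1 0 : series2 R) by exact/vanishZ/vanish1.
have Y1 : vanish 1 (mu2 *: mono2 0 1 : series2 R) by exact/vanishZ/vanish1.
apply: (continuous_linear_eq (phi := fun A => sub2 A _ _)
  (psi := fun A j k => mu1 ^+ j * mu2 ^+ k * A j k)).
- exact: sub2_linear.
- move=> a B C; apply: eq_series2 => j k; rewrite !add2E !scale2E; ring.
- by move=> n B; apply: vanish_sub2.
- by move=> n B Bn j k jk; rewrite Bn// mulr0.
move=> p q; rewrite sub2_mono2// !exprZn -scalerAl -scalerAr scalerA -mono2E.
apply: eq_series2 => j k; rewrite scale2E /mono2.
have [->|] := eqVneq j p; last by rewrite !mulr0.
by have [->|] := eqVneq k q; last by rewrite !mulr0.
Qed.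

End LeadingTerms.

Section Conjugation.
Context {R : realType}.
Implicit Types A B C F G H K L : series2 R.

Lemma bar2K : involutive (@bar2 R).
Proof. by move=> A; apply: eq_series2 => j k; rewrite /bar2 conjcK. Qed.

Lemma bar2B A B : bar2 (A - B) = bar2 A - bar2 B.
Proof. by apply: eq_series2 => j k; rewrite /bar2 !(add2E, opp2E) rmorphB. Qed.

Lemma bar2M A B : bar2 (A * B) = bar2 A * bar2 B.
Proof.
apply: eq_series2 => j k; rewrite /bar2 /GRing.mul/= /mul2 rmorph_sum/=.
under eq_bigr do rewrite rmorph_sum/=.
rewrite exchange_big/=; apply: eq_bigr => p _; apply: eq_bigr => q _.
by rewrite rmorphM.
Qed.

Lemma bar2_1 : bar2 1 = 1 :> series2 R.
Proof. by apply: eq_series2 => j k; rewrite /bar2 !one2E andbC rmorph_nat. Qed.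

Lemma bar2X A n : bar2 (A ^+ n) = bar2 A ^+ n.
Proof. by elim: n => [|n IH]; rewrite ?expr0 ?bar2_1// !exprS bar2M IH. Qed.

Lemma vanish_bar2 n A : vanish n A -> vanish n (bar2 A).
Proof. by move=> An j k jk; rewrite /bar2 An ?conjc0// addnC. Qed.

Lemma bar2_sub2 A F G : bar2 (sub2 A F G) = sub2 (bar2 A) (bar2 G) (bar2 F).
Proof.
apply: eq_series2 => j k; rewrite /bar2 /sub2 rmorph_sum addnC /=.
under eq_bigr do rewrite rmorph_sum/=.
rewrite exchange_big; apply: eq_bigr => p _; apply: eq_bigr => q _.
rewrite rmorphM; congr (_ * _).
by rewrite -!bar2X mulrC -bar2M.
Qed.

Lemma bar2_comp2 A F : bar2 (comp2 A F) = comp2 (bar2 A) F.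
Proof. by rewrite !comp2E bar2_sub2 bar2K. Qed.

Lemma vanish_comp2 n A F : vanish 1 F -> vanish n A -> vanish n (comp2 A F).
Proof. by move=> F1 An; rewrite comp2E; apply: vanish_sub2 => //; apply: vanish_bar2. Qed.

Lemma comp2A A F G : vanish 1 F -> vanish 1 G ->
  comp2 (comp2 A F) G = comp2 A (comp2 F G).
Proof.
move=> F1 G1; rewrite [in RHS]comp2E bar2_comp2 !comp2E sub2A//; exact: vanish_bar2.
Qed.

Lemma bar2_id2 : bar2 id2 = mono2 0 1 :> series2 R.
Proof. by apply: eq_series2 => j k; rewrite /bar2 /id2 /mono2 andbC rmorph_nat. Qed.

Lemma comp2_id A : comp2 A id2 = A.
Proof. by rewrite comp2E bar2_id2 sub2_id. Qed.

Lemma id2_comp F : vanish 1 F -> comp2 id2 F = F.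
Proof.
by move=> F1; rewrite comp2E sub2_mono2//; [rewrite expr0 expr1 mulr1|apply: vanish_bar2].
Qed.

(** In its lowest degree n, the composition D o F sees only the linear part of
F, which acts diagonally on monomials. This is the source of the factor
mu^j conj(mu)^k in the conjugacy equation. *)
Lemma comp2_lead n D F mu j k : has_linear_part mu F -> vanish n D ->
  (j + k = n)%N -> comp2 D F j k = mu ^+ j * mu^* ^+ k * D j k.
Proof.
move=> [F00 F10 F01] Dn jk; rewrite comp2E.
have F1 : vanish 1 F by exact: vanish1.
have FF' : vanish 2 (F - mu *: mono2 1 0).
  move=> [|[|a]] [|[|b]]//= _; rewrite add2E opp2E scale2E /mono2/=;
    by rewrite ?F00 ?F10 ?F01 ?(mulr0, mulr1) subrr.
have GG' : vanish 2 (bar2 F - mu^* *: mono2 0 1).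
  rewrite (_ : _ *: _ = bar2 (mu *: mono2 1 0)) -?bar2B; first exact: vanish_bar2.
  apply: eq_series2 => a b; rewrite /bar2 !scale2E rmorphM /=; congr (_ * _).
  by rewrite /mono2 andbC rmorph_nat.
have := @vanish_sub2D _ 2 n D F (mu *: mono2 1 0) (bar2 F) (mu^* *: mono2 0 1) isT F1.
rewrite sub2_dilation => /(_ _ (vanish_bar2 F1) _ FF' GG' Dn j k).
rewrite add2E opp2E => H; apply/eqP; rewrite -subr_eq0; apply/eqP; apply: H.
- exact/vanishZ/vanish1.
- exact/vanishZ/vanish1.
- by rewrite jk.
Qed.

End Conjugation.

(** * Series in one variable, triangular systems *)

Section OneVariable.
Context {R : realType}.
Implicit Types (A B C F G L : series2 R) (g h : nat -> R[i]).

(** Encoding a one-variable series as a two-variable one turns composition with it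
into an instance of [sub2], whose laws then apply. *)
Definition axis g : series2 R := fun j k => if k == 0%N then g j else 0.

(** Complex coefficients are allowed here because the reality of the transition
series is proved after it has been constructed. *)
Definition ccomp1 g L := sub2 (axis g) L 0.

Lemma ccomp1E g L j k :
  ccomp1 g L j k = \sum_(n < (j + k).+1) g n * (L ^+ n) j k.
Proof.
apply: eq_bigr => p _; rewrite big_ord_recl big1 ?addr0; last first.
  by move=> q _; rewrite mul0r.
by rewrite /axis eqxx expr0 mulr1.
Qed.

Lemma comp1E (g : nat -> R) L : comp1 g L = ccomp1 (fun n => (g n)%:C) L.
Proof.
by apply: eq_series2 => j k; rewrite ccomp1E; apply: eq_bigr => n _; rewrite exp2E.
Qed.

(** Triangular structure of g o L. As L = z zbar + ..., the coefficient g_k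
enters first in degree 2k, through (z zbar)^k, hence only on the diagonal; a
change of L in degree n acts through the linear coefficient of g. *)
Lemma ccomp1_diff n g g' L L' : (2 < n)%N ->
  vanish 3 (L - nu) -> vanish 3 (L' - nu) -> vanish n (L - L') ->
  (forall k, (k.*2 < n)%N -> g k = g' k) ->
  vanish n (ccomp1 g L - ccomp1 g' L') /\
  forall j k, (j + k = n)%N -> ccomp1 g L j k - ccomp1 g' L' j k =
     (if j == k then g j - g' j else 0) + g' 1%N * (L j k - L' j k).
Proof.
move=> n2 L3 L'3 LL' gg'.
have nu2 : vanish 2 (nu : series2 R) by exact: (@vanish_mono2 R 1 1).
have L2 : vanish 2 L.
  by rewrite -[L](subrK nu); apply: vanishD => //; apply: vanishW L3.
have L'2 : vanish 2 L'.
  by rewrite -[L'](subrK nu); apply: vanishD => //; apply: vanishW L'3.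
have z1 : vanish 1 (0 : series2 R) by exact: vanish_zero.
(* Change g only: the power L ^ p is (z zbar)^p up to degree 2p, so that only
   p = n / 2 contributes. *)
have low j k : (j + k <= n)%N -> ccomp1 g L j k - ccomp1 g' L j k =
    if (j + k == n)%N && (j == k) then g j - g' j else 0.
  move=> jk; rewrite !ccomp1E -sumrB.
  have E (p : nat) : g p * (L ^+ p) j k - g' p * (L ^+ p) j k =
      if ((j + k == n)%N && (j == k)) && (p == j) then g j - g' j else 0.
    rewrite -mulrBl; have [pn|pn] := ltnP p.*2 n.
      rewrite gg'// subrr mul0r; case: ifP => // /andP[/andP[/eqP ? /eqP ?] /eqP ?].
      by lia.
    have [jkp|jkp] := ltnP (j + k) p.*2.
      rewrite (vanishX L2); last by lia.
      by rewrite mulr0; case: ifP => // /andP[/andP[/eqP ? /eqP ?] /eqP ?]; lia.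
    have := @vanish_powD R 2 3 L nu p isT L2 nu2 L3 j k.
    rewrite add2E opp2E => /(_ _)/eqP; rewrite subr_eq0 => /(_ _)/eqP ->; last by lia.
    rewrite /nu mono2E exprMn -!exprM !mul1n -mono2E /mono2.
    have -> : (j + k == n)%N by lia.
    have [->|jp] := eqVneq j p => /=; last by rewrite mulr0 andbF.
    by rewrite andbT (eq_sym k); case: eqP => _; rewrite ?mulr1 ?mulr0.
  rewrite (eq_bigr (fun p : 'I_(j + k).+1 =>
    if ((j + k == n)%N && (j == k)) && (p == j :> nat) then g j - g' j else 0)
    (fun p _ => E p)).
  case: andP => [[jkn /eqP jk']|] /=; last first.
    by rewrite big1.
  have jlt : (j < (j + k).+1)%N by lia.
  rewrite (bigD1 (Ordinal jlt))//= eqxx big1 ?addr0// => p.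
  by rewrite -val_eqE/= => /negPf ->.
(* Change L only: by [sub2_diff], the linear coefficient of g' carries the whole
   effect in degree n. *)
have := @sub2_diff R n (axis g') L L' 0 0 (ltnW (ltnW n2))
  (@vanishW R 1 2 L isT L2) (@vanishW R 1 2 L' isT L'2) z1 z1 LL'.
rewrite subrr scaler0 addr0 => /(_ (@vanish_zero R n)).
rewrite -/(ccomp1 g' L) -/(ccomp1 g' L') => H.
have diffE j k : (j + k <= n)%N -> ccomp1 g L j k - ccomp1 g' L' j k =
    (if (j + k == n)%N && (j == k) then g j - g' j else 0) + g' 1%N * (L j k - L' j k).
  move=> jk; rewrite -low//; have /eqP := H j k jk.
  by rewrite !add2E !opp2E scale2E add2E opp2E subr_eq0 => /eqP <-; rewrite addrA subrK.
split=> j k jk.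
  rewrite add2E opp2E diffE; last by lia.
  have := LL' j k jk; rewrite add2E opp2E => ->; rewrite mulr0 addr0.
  by case: ifP => // /andP[/eqP]; lia.
by rewrite (diffE _ _ (eq_leq jk)) jk eqxx.
Qed.

End OneVariable.

Section Triangular.
Context {R : realType}.
Variables (m : nat) (A0 : series2 R) (E : series2 R -> series2 R).
Variable d : nat -> nat -> R[i].
Hypothesis d_neq0 : forall j k, (m <= j + k)%N -> d j k != 0.
Hypothesis E_triangular : forall M M', vanish m (M - A0) -> vanish m (M' - A0) ->
  forall j k, (m <= j + k)%N -> vanish (j + k) (M - M') ->
  E M j k - E M' j k = d j k * (M j k - M' j k).

(** Two solutions agree in degree n by induction on n, the pivot d being nonzero. *)
Lemma triangular_uniq M M' : vanish m (M - A0) -> vanish m (M' - A0) ->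
  (forall j k, (m <= j + k)%N -> E M j k = E M' j k) -> M = M'.
Proof.
move=> M0 M'0 EMM'; apply: vanish_eq; elim=> [//|n IH] j k.
rewrite ltnS leq_eqVlt => /predU1P[jk|]; last exact: IH.
have [jkm|jkm] := ltnP (j + k) m.
  exact: (vanish_trans M0 (vanish_sym M'0)).
have := E_triangular M0 M'0 jkm; rewrite jk => /(_ IH).
rewrite EMM'// subrr => /esym/eqP; rewrite mulf_eq0 (negPf (d_neq0 jkm)) /=.
by move/eqP.
Qed.

(** The iteration M |-> M - E M / d gains one correct degree at each step, so its
iterates stabilize coefficientwise. The first m degrees, where the system
need not be triangular, are prescribed by A0. *)
Lemma triangular_solution : exists2 M, vanish m (M - A0) &
  forall j k, (m <= j + k)%N -> E M j k = 0.
Proof.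
pose T M : series2 R := fun j k =>
  if (j + k < m)%N then A0 j k else M j k - E M j k / d j k.
pose u n := iter n T A0.
(* In degrees below n, all the iterates from u n on agree; M is their limit. *)
have T0 M : vanish m (T M - A0).
  by move=> j k jk; rewrite add2E opp2E /T jk subrr.
have u0 n : vanish m (u n - A0).
  by case: n => [|n]; [rewrite subrr; exact: vanish_zero|exact: T0].
have T_contract n M M' : vanish m (M - A0) -> vanish m (M' - A0) ->
    vanish n (M - M') -> vanish n.+1 (T M - T M').
  move=> M0 M'0 MM' j k jk; rewrite add2E opp2E /T.
  case: ltnP => jkm; first by rewrite subrr.
  have MM'jk : vanish (j + k) (M - M') by apply: vanishW MM'; rewrite -ltnS.
  have -> : M j k - E M j k / d j k - (M' j k - E M' j k / d j k) =
      M j k - M' j k - (d j k)^-1 * (E M j k - E M' j k) by ring.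
  by rewrite (E_triangular M0 M'0)// mulKf ?d_neq0// subrr.
have uS n : vanish n (u n.+1 - u n).
  elim: n => [//|n IH]; exact: T_contract.
have uD n p : vanish n (u (n + p)%N - u n).
  elim: p => [|p IH]; first by rewrite addn0 subrr; exact: vanish_zero.
  rewrite addnS; apply: vanish_trans IH.
  by apply: vanishW (uS _); exact: leq_addr.
pose M : series2 R := fun j k => u (j + k).+1 j k.
have Mu n : vanish n (M - u n).
  move=> j k jk; have := uD (j + k).+1 (n - (j + k).+1)%N j k (ltnSn _).
  by rewrite subnKC// !add2E !opp2E => /eqP; rewrite subr_eq0 => /eqP ->; rewrite subrr.
have M0 : vanish m (M - A0) by apply: vanish_trans (Mu m) (u0 m).
exists M => // j k jkm.
have : vanish (j + k).+1 (M - T M).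
  apply: (vanish_trans (Mu _)); apply: T_contract => //.
  exact/vanish_sym/Mu.
move=> /(_ j k (ltnSn _)); rewrite add2E opp2E /T ltnNge jkm/= opprB addrC subrK.
by move/eqP; rewrite mulf_eq0 invr_eq0 (negPf (d_neq0 jkm)) orbF => /eqP.
Qed.

End Triangular.

(** * Multipliers of irrational rotations *)

Section RotationMultipliers.
Context {R : realType}.

Lemma expi2piD (x y : R) : expi2pi (x + y) = expi2pi x * expi2pi y.
Proof.
rewrite /expi2pi !mulrDr cosD sinD; apply/eqP; rewrite eq_complex /=.
by rewrite eqxx addrC eqxx.
Qed.

Lemma expi2pi0 : expi2pi (0 : R) = 1.
Proof. by rewrite /expi2pi mulr0 cos0 sin0. Qed.

Lemma expi2piX (x : R) n : expi2pi x ^+ n = expi2pi (n%:R * x).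
Proof.
elim: n => [|n IH]; first by rewrite mul0r expi2pi0.
by rewrite exprS IH -expi2piD -natr1 mulrDl mul1r addrC.
Qed.

Lemma expi2pi_nat n : expi2pi (n%:R : R) = 1.
Proof.
rewrite -[n%:R]mulr1 -expi2piX [X in X ^+ n](_ : _ = 1) ?expr1n//.
by rewrite /expi2pi mulr1 mulr_natl cos2pi sin2pi.
Qed.

Lemma expi2pi_int (z : int) : expi2pi (z%:~R : R) = 1.
Proof.
case: z => n; first exact: expi2pi_nat.
have := expi2piD (Negz n)%:~R (n.+1%:R : R).
by rewrite NegzE mulrNz addNr expi2pi0 expi2pi_nat mulr1.
Qed.

(** Reduce modulo integers to 0 <= y < 1. There cos (2 pi y) = 1 forces
sin (pi y) = 0, while the sine is positive on the open interval (0, pi). *)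
Lemma expi2pi_eq1 (x : R) : expi2pi x = 1 -> x = (Num.floor x)%:~R.
Proof.
move=> x1; pose y := x - (Num.floor x)%:~R.
have y1 : expi2pi y = 1.
  by have := expi2piD y (Num.floor x)%:~R; rewrite /y subrK x1 expi2pi_int mulr1.
have [y0 ylt1] : 0 <= y /\ y < 1.
  by split; [rewrite subr_ge0 floor_le|rewrite ltrBlDl -intrD1 floorD1_gt].
have [|yneq0] := eqVneq y 0; first by move/eqP; rewrite subr_eq0 => /eqP.
have ypi : 0 < pi * y < pi.
  rewrite pmulr_rgt0 ?pi_gt0// lt_neqAle eq_sym yneq0 y0/=.
  by rewrite -[ltRHS]mulr1 ltr_pM2l// pi_gt0.
have := sin_gt0_pi ypi.
move: y1 => /(congr1 (@complex.Re R)) /=.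
rewrite (_ : 2 * pi * y = (pi * y) *+ 2); last by rewrite -mulrA mulr_natl.
rewrite cos_mulr2n cos2sin2 => H.
suff : sin (pi * y) ^+ 2 = 0 by move/eqP; rewrite sqrf_eq0 => /eqP ->; rewrite ltxx.
lra.
Qed.

Lemma expi2pi_irrational (omega : R) n : irrational omega -> (0 < n)%N ->
  expi2pi omega ^+ n != 1.
Proof.
move=> irr n0; apply/eqP; rewrite expi2piX => /expi2pi_eq1 H; apply: irr.
apply/rationalP; exists (Num.floor (n%:R * omega)), n.
by rewrite -H mulrC mulKf// pnatr_eq0 -lt0n.
Qed.

Lemma norm1_mulC (mu : R[i]) : `|mu| = 1 -> mu * mu^* = 1.
Proof. by move=> mu1; rewrite -sqr_normc mu1 expr1n. Qed.

Lemma norm_expi2pi (omega : R) : `|expi2pi omega| = 1.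
Proof. by rewrite normc_def /= cos2Dsin2 sqrtr1. Qed.

Lemma conjc_eq1 (x : R[i]) : (x^* == 1) = (x == 1).
Proof. by rewrite -[LHS](inj_eq (can_inj (@conjcK _))) conjcK conjc1. Qed.

Lemma rotation_multiplier_neq1 (mu : R[i]) j k : `|mu| = 1 ->
  (forall n, (0 < n)%N -> mu ^+ n != 1) -> j != k -> mu ^+ j * mu^* ^+ k != 1.
Proof.
move=> /norm1_mulC mu1 mun jk.
(* As mu conj(mu) = 1, only the difference of the exponents matters; the case
   j < k is reduced to k < j by conjugation. *)
have E a b : mu ^+ (a + b) * mu^* ^+ a = mu ^+ b.
  by rewrite exprD mulrAC -exprMn mu1 expr1n mul1r.
have [jltk|kltj|jk'] := ltngtP j k; last by rewrite jk' eqxx in jk.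
- rewrite -(conjc_eq1 (mu ^+ j * _)).
  have -> : (mu ^+ j * mu^* ^+ k)^* = mu ^+ (j + (k - j)) * mu^* ^+ j.
    by rewrite subnKC 1?ltnW// rmorphM !rmorphXn/= conjcK mulrC.
  by rewrite E mun// subn_gt0.
- by rewrite -{1}(subnKC (ltnW kltj)) E mun// subn_gt0.
Qed.
End RotationMultipliers.

(** * The groups of diffeomorphisms and of transition series *)

Section Groups.
Context {R : realType}.
Implicit Types (F G L : series2 R) (g h : nat -> R).

Lemma has_linear_part_vanish mu F : has_linear_part mu F -> vanish 1 F.
Proof. by case=> F0 _ _; exact: vanish1. Qed.

Lemma setF_vanish F : setF F -> vanish 1 F.
Proof. by case=> mu _; exact: has_linear_part_vanish. Qed.

Lemma has_linear_part_comp mu mu' F G :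
  has_linear_part mu F -> has_linear_part mu' G ->
  has_linear_part (mu * mu') (comp2 F G).
Proof.
move=> Fmu Gmu'; have G1 := has_linear_part_vanish Gmu'.
have bG1 := vanish_bar2 G1; case: Fmu Gmu' => F0 F10 F01 [G0 G10 G01].
by split; rewrite comp2E ?sub2_coef00// sub2_lin// F10 F01 ?G10 ?G01 mul0r addr0 ?mulr0.
Qed.

Lemma setF_comp F G : setF F -> setF G -> setF (comp2 F G).
Proof.
move=> [mu mu1 Fmu] [mu' mu'1 Gmu']; exists (mu * mu').
  by rewrite normrM mu1 mu'1 mulr1.
exact: has_linear_part_comp.
Qed.

Lemma tangent_setF F : tangent_to_id F -> setF F.
Proof. by move=> F1; exists 1 => //; rewrite normr1. Qed.

(** F o M = id is triangular in M with constant pivot mu, by [sub2_diff]. *)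
Lemma setF_right_inverse F : setF F -> exists2 G, setF G & comp2 F G = id2.
Proof.
move=> [mu mu1 [F0 F10 F01]].
have mu0 : mu != 0 by rewrite -normr_eq0 mu1 oner_eq0.
have [|M M' M1 M'1 j k jk MM'|M M1 FM] := @triangular_solution R 1 0
    (fun M => comp2 F M - id2) (fun _ _ => mu).
- by move=> j k _.
- rewrite subr0 in M1; rewrite subr0 in M'1.
  have := @sub2_diff R (j + k) F M M' (bar2 M) (bar2 M') jk M1 M'1
    (vanish_bar2 M1) (vanish_bar2 M'1) MM'.
  rewrite -bar2B => /(_ (vanish_bar2 MM') j k (ltnSn _)).
  rewrite -!comp2E F01 F10 !(add2E, opp2E, scale2E) mul0r addr0 => /eqP.
  by rewrite subr_eq0 => /eqP <-; ring.
rewrite subr0 in M1.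
have FMid : comp2 F M = id2.
  apply: eq_series2 => j k; have [jk|] := ltnP 0 (j + k).
    by have := FM j k jk; rewrite add2E opp2E => /eqP; rewrite subr_eq0 => /eqP.
  by case: j => // -[]//; case: k => // _; rewrite comp2E sub2_coef00 F0.
exists M => //.
have /= M10 := congr1 (fun A : series2 R => A 1%N 0%N) FMid.
have /= M01 := congr1 (fun A : series2 R => A 0%N 1%N) FMid.
move: M10 M01; rewrite comp2E !sub2_lin ?F01 ?F10 ?mul0r ?addr0//;
  try exact: vanish_bar2.
rewrite /id2 /mono2/= => M10 /eqP; rewrite mulf_eq0 (negPf mu0)/= => /eqP M01.
exists (M 1%N 0%N); last by split => //; exact: M1.
by have /(congr1 Num.norm) := M10; rewrite normrM mu1 mul1r normr1.
Qed.

(** In a monoid where every element has a right inverse, right inverses are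
two-sided. *)
Lemma inv2P F : setF F ->
  [/\ setF (inv2 F), comp2 F (inv2 F) = id2 & comp2 (inv2 F) F = id2].
Proof.
move=> Fin; have [G Gin FG] := setF_right_inverse Fin.
have [H Hin GH] := setF_right_inverse Gin.
apply: (@xgetPex _ id2 [set F' | [/\ setF F', comp2 F F' = id2 & comp2 F' F = id2]]).
exists G; split => //.
(* F = F o (G o H) = (F o G) o H = H *)
have -> : F = H; last by [].
have [G1 H1] := (setF_vanish Gin, setF_vanish Hin).
by rewrite -[F]comp2_id -GH -comp2A// FG id2_comp.
Qed.

Lemma setL_P L : setL L <-> vanish 3 (L - nu) /\ bar2 L = L.
Proof.
split=> [[Lnu Lbar]|[Lnu Lbar]].
  split; first by move=> j k jk; rewrite add2E opp2E Lnu ?subrr.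
  by apply: eq_series2 => j k; rewrite [RHS]Lbar.
split=> [j k jk|r s]; last by rewrite -[in LHS]Lbar.
by have /eqP := Lnu j k jk; rewrite add2E opp2E subr_eq0 => /eqP.
Qed.

Lemma vanish_nu : vanish 2 (nu : series2 R).
Proof. exact: (@vanish_mono2 R 1 1). Qed.

Lemma vanish3_nu L : vanish 3 (L - nu) -> vanish 1 L.
Proof.
move=> L3; rewrite -[L](subrK nu); apply: vanishD.
  by apply: vanishW L3.
by apply: vanishW vanish_nu.
Qed.

Lemma setL_vanish L : setL L -> vanish 1 L.
Proof. by move=> /setL_P[/vanish3_nu]. Qed.

Lemma setL_nu : setL (nu : series2 R).
Proof.
apply/setL_P; split; first by rewrite subrr; exact: vanish_zero.
by apply: eq_series2 => j k; rewrite /bar2 /nu /mono2 andbC rmorph_nat.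
Qed.

Lemma comp2B A B F : comp2 (A - B) F = comp2 A F - comp2 B F.
Proof. by rewrite !comp2E sub2B. Qed.

Lemma comp2_nu_vanish L F : setF F -> vanish 3 (L - nu) ->
  vanish 3 (comp2 L F - nu).
Proof.
move=> [mu mu1 Fmu] L3; have F1 := has_linear_part_vanish Fmu.
apply: (@vanish_trans R 3 _ (comp2 nu F)).
  by rewrite -comp2B; apply: vanish_comp2.
move=> j k; rewrite ltnS leq_eqVlt add2E opp2E => /predU1P[jk|jk]; last first.
  by rewrite vanish_nu// (vanish_comp2 F1 vanish_nu)// subrr.
rewrite (comp2_lead Fmu vanish_nu jk) /nu /mono2.
case: eqP => [->|_]; last by rewrite mulr0 subrr.
by case: eqP => [->|_]; rewrite ?(mulr0, mulr1) ?expr1 ?norm1_mulC// subrr.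
Qed.

Lemma setL_comp2 L F : setL L -> setF F -> setL (comp2 L F).
Proof.
move=> /setL_P[L3 Lb] FF; apply/setL_P; split; first exact: comp2_nu_vanish.
by rewrite bar2_comp2 Lb.
Qed.

Definition idG : nat -> R := fun n => (n == 1%N)%:R.

Lemma comp1_id L : vanish 1 L -> comp1 idG L = L.
Proof.
move=> L1; rewrite comp1E /ccomp1.
have -> : axis (fun n => (idG n)%:C) = mono2 1 0 :> series2 R.
  apply: eq_series2 => j k; rewrite /axis /idG /mono2 rmorph_nat.
  by case: ifP => _; rewrite ?andbT ?andbF.
by rewrite sub2_mono2 ?expr1 ?expr0 ?mulr1//; exact: vanish_zero.
Qed.

Lemma ccomp1_nu_vanish (g : nat -> R[i]) L : g 0%N = 0 -> g 1%N = 1 ->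
  vanish 3 (L - nu) -> vanish 3 (ccomp1 g L - nu).
Proof.
move=> g0 g1 L3; apply: (@vanish_trans R 3 _ L) => //.
rewrite -[X in _ - X](comp1_id (vanish3_nu L3)) comp1E.
have [|[|[|k]]|//] := @ccomp1_diff R 3 g (fun n => (idG n)%:C) L L isT L3 L3.
- by rewrite subrr; exact: vanish_zero.
- by rewrite g0 rmorph_nat.
- by rewrite g1 rmorph_nat.
- by rewrite !doubleS.
Qed.

Lemma bar2_ccomp1 (g : nat -> R[i]) L :
  bar2 (ccomp1 g L) = ccomp1 (fun n => (g n)^*) (bar2 L).
Proof.
apply: eq_series2 => j k; rewrite /bar2 !ccomp1E rmorph_sum/= addnC.
by apply: eq_bigr => n _; rewrite rmorphM/= -bar2X.
Qed.

Lemma setL_comp1 g L : setG g -> setL L -> setL (comp1 g L).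
Proof.
move=> [g0 g1] /setL_P[L3 Lb]; apply/setL_P; rewrite comp1E; split.
  by apply: ccomp1_nu_vanish => //; rewrite ?g0 ?g1.
rewrite bar2_ccomp1 Lb; congr ccomp1; apply/funext => n; exact: conjc_real.
Qed.

Lemma comp1_comp2 g L F : vanish 1 L -> vanish 1 F ->
  comp2 (comp1 g L) F = comp1 g (comp2 L F).
Proof.
move=> L1 F1; rewrite !comp1E comp2E /ccomp1 sub2A//; last exact: vanish_bar2.
by rewrite -comp2E sub20.
Qed.

(** Setting zbar = 0 projects onto the series depending on z alone. *)
Lemma axis_sub2 (A : series2 R) :
  sub2 A (mono2 1 0) 0 = axis (fun n => A n 0%N).
Proof.
have X1 : vanish 1 (mono2 1 0 : series2 R) by exact: vanish1.
have z1 : vanish 1 (0 : series2 R) by exact: vanish_zero.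
apply: (continuous_linear_eq (phi := fun A => sub2 A _ _)
  (psi := fun A => axis (fun n => A n 0%N))).
- exact: sub2_linear.
- move=> a B C; apply: eq_series2 => j k; rewrite add2E scale2E /axis.
  by case: ifP => _; rewrite ?mulr0 ?addr0.
- by move=> n B; apply: vanish_sub2.
- move=> n B Bn j k jk; rewrite /axis; case: ifP => // /eqP k0.
  by apply: Bn; rewrite k0 in jk.
move=> p q; rewrite sub2_mono2//; apply: eq_series2 => j k.
case: q => [|q].
  rewrite expr0 mulr1 -[_ ^+ p]mulr1 -(expr0 (mono2 0 1)) -mono2E.
  by rewrite /axis /mono2; case: (k =P 0%N) => _ /=; rewrite ?eqxx ?andbT ?andbF.
rewrite expr0n mulr0 /axis /mono2 andbF; by case: ifP.
Qed.

(** Used for the composition of transition series, whose coefficients have to be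
real numbers and not merely complex ones. *)
Definition real_coefs (A : series2 R) := forall j k, A j k \is Num.real.

Lemma real_coefsM A B : real_coefs A -> real_coefs B -> real_coefs (A * B).
Proof.
move=> Ar Br j k; apply: rpred_sum => p _; apply: rpred_sum => q _.
exact: rpredM.
Qed.

Lemma real_coefsX A n : real_coefs A -> real_coefs (A ^+ n).
Proof.
move=> Ar; elim: n => [|n IH]; last by rewrite exprS; apply: real_coefsM.
by move=> j k; rewrite expr0 one2E realn.
Qed.

Lemma setG_comp g h : setG g -> setG h ->
  exists2 f, setG f & forall L, vanish 1 L -> comp1 g (comp1 h L) = comp1 f L.
Proof.
move=> [g0 g1] [h0 h1].
pose ax (g : nat -> R) := axis (fun n => (g n)%:C).
have z1 : vanish 1 (0 : series2 R) by exact: vanish_zero.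
have X1 : vanish 1 (mono2 1 0 : series2 R) by exact: vanish1.
have h1' : vanish 1 (ax h) by apply: vanish1; rewrite /ax/axis/= h0.
pose gh := sub2 (ax g) (ax h) 0.
have ghr : real_coefs gh.
  have axr f : real_coefs (ax f).
    by move=> j k; rewrite /ax /axis; case: ifP => _; rewrite ?complex_real.
  move=> j k; apply: rpred_sum => p _; apply: rpred_sum => q _.
  apply: rpredM; first exact: axr.
  by apply: real_coefsM; apply: real_coefsX => // a b; rewrite real0.
have ghE : gh = ax (fun n => complex.Re (gh n 0%N)).
  rewrite {1}/gh -[in LHS](_ : sub2 (ax h) (mono2 1 0) 0 = ax h); last first.
    by rewrite axis_sub2.
  rewrite -[X in sub2 _ _ X](sub20 (mono2 1 0) 0) -sub2A//.
  rewrite axis_sub2; congr axis; apply/funext => n.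
  by rewrite RRe_real.
exists (fun n => complex.Re (gh n 0%N)).
  split; first by rewrite /gh sub2_coef00 /ax /axis/= g0.
  have ax1 f : f 1%N = 1 -> ax f 1%N 0%N = 1 by rewrite /ax /axis/= => ->.
  have gh1 : gh 1%N 0%N = 1 by rewrite /gh sub2_lin// !ax1// mulr0 addr0 mulr1.
  by rewrite gh1.
have axE f L : comp1 f L = sub2 (ax f) L 0 by rewrite comp1E.
move=> L L1; rewrite !axE -ghE.
by rewrite /gh sub2A// sub20.
Qed.

End Groups.

(** * The conjugacy equation *)

Section Cohomological.
Context {R : realType}.
Implicit Types (F G L M : series2 R) (g h : nat -> R).

Lemma conj_fixed_real (x : R[i]) : x^* = x -> x = (complex.Re x)%:C.
Proof.
case: x => a b /= [bb]; congr (_ +i* _).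
by lra.
Qed.

(** The unknown M of the conjugacy equation stores L off the diagonal
and g on it. Here L is read off: its diagonal is the prescribed delta, and in
degree at most 2 it is z zbar. *)
Definition series_part (delta : nat -> R[i]) M : series2 R := fun j k =>
  if (j + k < 3)%N then nu j k else if j == k then delta j else M j k.

(** The transition series g read off the diagonal of the unknown M, with linear
term 1. *)
Definition transition_part M : nat -> R[i] := fun n =>
  if (n < 2)%N then (n == 1%N)%:R else M n n.

Lemma series_part_nu delta M : vanish 3 (series_part delta M - nu).
Proof. by move=> j k jk; rewrite add2E opp2E /series_part jk subrr. Qed.

Lemma vanish_series_partB delta n M M' :
  vanish n (M - M') -> vanish n (series_part delta M - series_part delta M').
Proof.
move=> MM' j k jk; rewrite add2E opp2E /series_part.
by case: ifP => _; [|case: ifP => _]; rewrite ?subrr//; exact: MM'.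
Qed.

Lemma eq_transition_part n M M' k : vanish n (M - M') -> (k.*2 < n)%N ->
  transition_part M k = transition_part M' k.
Proof.
move=> MM' kn; rewrite /transition_part; case: ifP => // _; apply/eqP; rewrite -subr_eq0.
by apply/eqP/MM'; rewrite addnn.
Qed.

Lemma transition_part_real M : bar2 M = M ->
  exists2 g, setG g & transition_part M = (fun n => (g n)%:C).
Proof.
move=> Mb.
exists (fun n => if (n < 2)%N then (n == 1%N)%:R else complex.Re (M n n)) => //.
apply/funext => n; rewrite /transition_part; case: ifP => _; first by rewrite rmorph_nat.
by rewrite -conj_fixed_real// -[in RHS]Mb.
Qed.

(** By [ccomp1_diff], the coefficient of (z zbar)^k in g o L is g_k plus terms
in the previous coefficients of g, so g can be found recursively. It is real
since its conjugate satisfies the same system. *)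
Lemma adjust_diagonal L L' : setL L -> setL L' ->
  exists2 g, setG g & forall k, comp1 g L k k = L' k k.
Proof.
move=> /setL_P[L3 Lb] /setL_P[L'3 L'b].
pose E M : series2 R := fun j k =>
  if j == k then ccomp1 (transition_part M) L j j - L' j j else M j k.
have Etri M M' : vanish 3 (M - 0) -> vanish 3 (M' - 0) ->
    forall j k, (3 <= j + k)%N -> vanish (j + k) (M - M') ->
    E M j k - E M' j k = 1 * (M j k - M' j k).
  move=> _ _ j k jk MM'; rewrite mul1r /E; case: eqP => // jk'.
  have LL : vanish (j + k) (L - L) by rewrite subrr; exact: vanish_zero.
  have [_ /(_ j k erefl)] := ccomp1_diff jk L3 L3 LL (fun i => @eq_transition_part _ M M' i MM').
  rewrite -jk' eqxx subrr mulr0 addr0 /transition_part ltnNge (_ : 1 < j)%N//=; last by lia.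
  by move=> <-; ring.
have d0 (j k : nat) : (3 <= j + k)%N -> 1 != 0 :> R[i] by rewrite oner_eq0.
have [M M3 EM] := triangular_solution (d := fun _ _ => 1) d0 Etri.
have Mb : bar2 M = M.
  have M3' : vanish 3 (bar2 M - 0) by move: M3; rewrite !subr0; exact: vanish_bar2.
  apply: (triangular_uniq (d := fun _ _ => 1) d0 Etri M3' M3) => j k jk.
  rewrite EM// -[RHS](conjc0 R) -(EM k j) 1?addnC// /E eq_sym.
  case: eqP => [->|//]; rewrite rmorphB; congr (_ - _); last by rewrite -[in LHS]L'b.
  rewrite -[RHS]/(bar2 (ccomp1 (transition_part M) L) _ _) bar2_ccomp1 Lb; congr ccomp1.
  apply/funext => n; rewrite /transition_part; case: ifP => // _.
  by rewrite rmorph_nat.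
have [g gG gE] := transition_part_real Mb; exists g => // k.
have [k2|k2] := ltnP (k + k) 3.
  have := @setL_comp1 R g L gG => /(_ _)/setL_P[|gL3 _]; first exact/setL_P.
  have := gL3 k k k2; have := L'3 k k k2; rewrite !add2E !opp2E.
  by move=> /eqP; rewrite subr_eq0 => /eqP -> /eqP; rewrite subr_eq0 => /eqP ->.
have := EM k k k2; rewrite /E eqxx comp1E gE => /eqP.
by rewrite subr_eq0 => /eqP ->.
Qed.

Lemma comp1_nu_diag g k : comp1 g nu k k = (g k)%:C.
Proof.
rewrite comp1E ccomp1E.
have nuX n : nu ^+ n = mono2 n n :> series2 R.
  by rewrite /nu mono2E exprMn -!exprM !mul1n -mono2E.
have klt : (k < (k + k).+1)%N by lia.
rewrite (bigD1 (Ordinal klt))//= nuX /mono2 !eqxx mulr1 big1 ?addr0//.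
by move=> n; rewrite -val_eqE/= nuX /mono2 eq_sym => /negPf ->; rewrite mulr0.
Qed.

(** Choose h such that h o (g o nu) has the diagonal of nu; the series in z zbar
are determined by their diagonal, hence h o g is the identity. *)
Lemma setG_left_inverse g : setG g ->
  exists2 h, setG h & forall L, vanish 1 L -> comp1 h (comp1 g L) = L.
Proof.
move=> gG; have [h hG hg] := adjust_diagonal (setL_comp1 gG setL_nu) setL_nu.
exists h => // L L1; have [f fG hgf] := setG_comp hG gG.
rewrite hgf// -[RHS]comp1_id//; congr comp1; apply/funext => k.
have := hg k; rewrite hgf; last exact/setL_vanish/setL_nu.
rewrite comp1_nu_diag -[in nu _ _](comp1_id (setL_vanish setL_nu)) comp1_nu_diag.
exact: complexI.
Qed.

(** If L o F = f o L, then (g o L) o F = (g o f o g^-1) o (g o L). *)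
Lemma admissible_comp1 F L g : vanish 1 F -> setG g ->
  admissible F L -> admissible F (comp1 g L).
Proof.
move=> F1 gG [LL [f fG LF]]; split; first exact: setL_comp1.
(* With f the transition series of L, that of g o L is l = g o f o h. *)
have [h hG hg] := setG_left_inverse gG.
have L1 := setL_vanish LL; have gL1 := setL_vanish (setL_comp1 gG LL).
have [k kG fh] := setG_comp fG hG; have [l lG gk] := setG_comp gG kG.
exists l => //.
by rewrite comp1_comp2// LF -gk// -fh// hg.
Qed.

Lemma comp2_comp1_low mu F L g : `|mu| = 1 -> has_linear_part mu F ->
  setG g -> vanish 3 (L - nu) ->
  vanish 3 (comp2 L F - ccomp1 (fun n => (g n)%:C) L).
Proof.
move=> mu1 Fmu [g0 g1] L3; apply: (@vanish_trans R 3 _ nu).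
  by apply: comp2_nu_vanish => //; exists mu.
by apply/vanish_sym/ccomp1_nu_vanish => //; rewrite ?g0 ?g1.
Qed.

Variables (mu : R[i]) (F : series2 R).
Hypothesis mu1 : `|mu| = 1.
Hypothesis mu_nonresonant : forall n, (0 < n)%N -> mu ^+ n != 1.
Hypothesis F_linear : has_linear_part mu F.

(** The pivots of the conjugacy equation. On the diagonal the multiplier of L_rr
vanishes and the pivot is that of the unknown g_r instead. *)
Definition small_divisor (j k : nat) : R[i] :=
  if j == k then -1 else mu ^+ j * mu^* ^+ k - 1.

Lemma small_divisor_neq0 j k : (3 <= j + k)%N -> small_divisor j k != 0.
Proof.
move=> _; rewrite /small_divisor; case: ifPn => jk; first by rewrite oppr_eq0 oner_eq0.
by rewrite subr_eq0; exact: rotation_multiplier_neq1.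
Qed.

Definition defect delta M : series2 R :=
  comp2 (series_part delta M) F - ccomp1 (transition_part M) (series_part delta M).

Lemma defect_triangular delta M M' :
  vanish 3 (M - 0) -> vanish 3 (M' - 0) ->
  forall j k, (3 <= j + k)%N -> vanish (j + k) (M - M') ->
  defect delta M j k - defect delta M' j k = small_divisor j k * (M j k - M' j k).
Proof.
move=> _ _ j k jk MM'; have LL' := vanish_series_partB delta MM'.
have [_ /(_ j k erefl)] := ccomp1_diff jk (@series_part_nu delta M) (@series_part_nu delta M') LL'
  (fun i => @eq_transition_part _ M M' i MM').
have := comp2_lead F_linear LL' (erefl (j + k)%N).
rewrite comp2B /defect !add2E !opp2E [transition_part M' 1%N]/= mul1r => H1 H2.
rewrite opprD addrACA -opprD H1 H2.
rewrite /small_divisor /series_part ltnNge jk/=.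
have [jk'|_] := eqVneq j k; last by ring.
rewrite -jk' subrr mulr0 addr0 /transition_part ltnNge (_ : 1 < j)%N; last by lia.
by rewrite /=; ring.
Qed.

(** The equation is solved with zero diagonal. The conjugate of the solution
solves the same system, so both agree and L and g are real. In degrees below 3
the equation holds because F is a rotation to first order. *)
Lemma admissible_exists : exists L, admissible F L.
Proof.
pose delta (n : nat) : R[i] := 0.
have [M M3 EM] := triangular_solution small_divisor_neq0 (@defect_triangular delta).
have Lb N : bar2 (series_part delta N) = series_part delta (bar2 N).
  apply: eq_series2 => j k; rewrite /bar2 /series_part addnC; case: ifP => _.
    by rewrite /nu /mono2 andbC rmorph_nat.
  by rewrite eq_sym; case: ifP => _ //; rewrite conjc0.
have gb N : (fun n => (transition_part N n)^*) = transition_part (bar2 N).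
  by apply/funext => n; rewrite /transition_part; case: ifP => _ //; rewrite rmorph_nat.
have Mb : bar2 M = M.
  have M3' : vanish 3 (bar2 M - 0) by move: M3; rewrite !subr0; exact: vanish_bar2.
  apply: (triangular_uniq small_divisor_neq0 (@defect_triangular delta) M3' M3) => j k jk.
  rewrite EM// /defect -Lb -gb -bar2_ccomp1 -bar2_comp2 -bar2B /bar2 -/(defect delta M).
  by rewrite EM ?conjc0// addnC.
have [g gG gE] := transition_part_real Mb.
have LL : setL (series_part delta M).
  by apply/setL_P; rewrite Lb Mb; split=> //; exact: series_part_nu.
exists (series_part delta M); split => //; exists g => //.
rewrite comp1E; apply: eq_series2 => j k; apply/eqP; rewrite -subr_eq0; apply/eqP.
have [jk|jk] := ltnP (j + k) 3; last by have := EM j k jk; rewrite /defect gE.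
by apply: (comp2_comp1_low mu1 F_linear gG _ jk); exact: series_part_nu.
Qed.

(** Packing L and its transition series g into one unknown M turns
admissible series with diagonal delta into solutions of one triangular system. *)
Lemma admissible_diag_uniq L L' : admissible F L -> admissible F L' ->
  (forall k, L k k = L' k k) -> L = L'.
Proof.
pose encode L g : series2 R := fun j k =>
  if (j + k < 3)%N then 0 else if j == k then (g j)%:C else L j k.
have encode3 L0 g : vanish 3 (encode L0 g - 0).
  by rewrite subr0 => j k jk; rewrite /encode jk.
have transitionE L0 g : setG g -> transition_part (encode L0 g) = (fun n => (g n)%:C).
  move=> [g0 g1]; apply/funext => n; rewrite /transition_part /encode eqxx.
  case: ltnP => [|n2]; last by rewrite ifF//; lia.
  by case: n => [|[|n]]// _; rewrite ?g0 ?g1.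
have seriesE L0 g : setL L0 -> series_part (fun n => L0 n n) (encode L0 g) = L0.
  move=> [L0nu _]; apply: eq_series2 => j k; rewrite /series_part /encode.
  by case: ltnP => jk; [rewrite L0nu|case: eqP => [->|]].
move=> [LL [g gG LF]] [L'L [g' g'G L'F]] LL'.
pose delta n := L n n; pose M := encode L g; pose M' := encode L' g'.
have LM : series_part delta M = L by exact: seriesE.
have LM' : series_part delta M' = L'.
  by rewrite -[RHS](seriesE L' g')//; congr series_part; apply/funext => n; exact: LL'.
have gM : transition_part M = (fun n => (g n)%:C) by exact: transitionE.
have gM' : transition_part M' = (fun n => (g' n)%:C) by exact: transitionE.
have ME : vanish 3 (M - 0) by exact: encode3.
have M'E : vanish 3 (M' - 0) by exact: encode3.
rewrite -LM -LM'; congr series_part.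
apply: (triangular_uniq small_divisor_neq0 (@defect_triangular delta) ME M'E) => j k jk.
by rewrite /defect LM LM' gM gM' LF L'F !comp1E !subrr.
Qed.

(** Move L inside its orbit until its diagonal is that of L'. *)
Lemma admissible_orbit L L' : admissible F L -> admissible F L' ->
  exists2 g, setG g & L' = comp1 g L.
Proof.
move=> FL FL'; have [g gG gd] := adjust_diagonal FL.1 FL'.1.
exists g => //; apply/esym/admissible_diag_uniq => //.
by apply: admissible_comp1 => //; exact: has_linear_part_vanish F_linear.
Qed.

End Cohomological.

(** * Convergence of compositions *)

Section Convergence.
Context {R : realType}.
Implicit Types (A B F : series2 R) (rho : R).
Notation normc := Normc.normc.

Lemma normc_ge0 (x : R[i]) : 0 <= normc x.
Proof. by case: x => a b; exact: sqrtr_ge0. Qed.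

Lemma normc_conj (x : R[i]) : normc x^* = normc x.
Proof. by case: x => a b; rewrite /= sqrrN. Qed.

Lemma normc_sum I (r : seq I) (P : pred I) (f : I -> R[i]) :
  normc (\sum_(i <- r | P i) f i) <= \sum_(i <- r | P i) normc (f i).
Proof.
elim/big_rec2: _ => [|i x y _ xy]; first by rewrite Normc.normc0.
exact: le_trans (le_normcD _ _) (lerD _ xy).
Qed.

(** The l1 norm at radius rho, truncated so as to exist for every formal series;
a series converges when its truncated norms are bounded for some rho > 0. *)
Definition wnorm rho n A : R :=
  \sum_(j < n) \sum_(k < n) normc (A j k) * rho ^+ (j + k).

Lemma wnorm_ge0 rho n A : 0 <= rho -> 0 <= wnorm rho n A.
Proof.
move=> rho0; apply: sumr_ge0 => j _; apply: sumr_ge0 => k _.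
by rewrite mulr_ge0 ?normc_ge0 ?exprn_ge0.
Qed.

(** The pairs (p, j - p) with p <= j < n are distinct pairs of the square. *)
Lemma le_sum_triangle n (f : nat -> nat -> R) : (forall p i, 0 <= f p i) ->
  \sum_(j < n) \sum_(p < j.+1) f p (j - p)%N <= \sum_(p < n) \sum_(i < n) f p i.
Proof.
move=> f0; apply: (@le_trans _ _ (\sum_(p < n) \sum_(i < n - p) f p i)).
  elim: n => [|n IH]; first by rewrite !big_ord0.
  rewrite big_ord_recr/= [leRHS](_ : _ =
    \sum_(p < n.+1) (\sum_(i < n - p) f p i + f p (n - p)%N)); last first.
    by apply: eq_bigr => p _; rewrite subSn -1?ltnS// big_ord_recr.
  rewrite big_split/= lerD2r big_ord_recr/= subnn big_ord0 addr0.
  exact: IH.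
apply: ler_sum => p _.
rewrite (big_ord_widen n (f p))// 1?leq_subr// big_mkcond.
by apply: ler_sum => i _; case: ifP.
Qed.

Lemma wnormM rho n A B : 0 <= rho ->
  wnorm rho n (A * B) <= wnorm rho n A * wnorm rho n B.
Proof.
move=> rho0.
pose a p q := normc (A p q) * rho ^+ (p + q).
pose b p q := normc (B p q) * rho ^+ (p + q).
have a0 p q : 0 <= a p q by rewrite mulr_ge0 ?normc_ge0 ?exprn_ge0.
have b0 p q : 0 <= b p q by rewrite mulr_ge0 ?normc_ge0 ?exprn_ge0.
apply: (@le_trans _ _ (\sum_(j < n) \sum_(p < j.+1)
    \sum_(k < n) \sum_(q < k.+1) a p q * b (j - p)%N (k - q)%N)).
  apply: ler_sum => j _; rewrite exchange_big/=; apply: ler_sum => k _.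
  rewrite /GRing.mul/= /mul2.
  apply: le_trans (ler_wpM2r (exprn_ge0 _ rho0) (normc_sum _ _ _)) _.
  rewrite mulr_suml; apply: ler_sum => p _.
  apply: le_trans (ler_wpM2r (exprn_ge0 _ rho0) (normc_sum _ _ _)) _.
  rewrite mulr_suml; apply: ler_sum => q _.
  rewrite Normc.normcM /a /b [leRHS]mulrACA -exprD.
  by rewrite (_ : (p + q + _)%N = (j + k)%N)//; have := ltn_ord p; have := ltn_ord q; lia.
apply: (@le_trans _ _ (\sum_(j < n) \sum_(p < j.+1)
    \sum_(q < n) \sum_(i < n) a p q * b (j - p)%N i)).
  apply: ler_sum => j _; apply: ler_sum => p _.
  apply: (@le_sum_triangle n (fun q i => a p q * b (j - p)%N i)) => q i.
  by rewrite mulr_ge0.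
apply: le_trans (@le_sum_triangle n
  (fun p l => \sum_(q < n) \sum_(i < n) a p q * b l i) _) _.
  by move=> p l; do 2!apply: sumr_ge0 => ? _; rewrite mulr_ge0.
rewrite /wnorm mulr_suml; apply: ler_sum => p _; rewrite mulr_suml exchange_big/=.
apply: ler_sum => q _; rewrite mulr_sumr; apply: ler_sum => l _.
by rewrite mulr_sumr.
Qed.

Lemma wnorm1 rho n : wnorm rho n 1 <= 1.
Proof.
case: n => [|n]; first by rewrite /wnorm big_ord0.
rewrite /wnorm big_ord_recl [X in _ + X]big1 ?addr0; last first.
  by move=> j _; rewrite big1// => k _; rewrite one2E Normc.normc0 mul0r.
rewrite big_ord_recl [X in _ + X]big1 ?addr0; last first.
  by move=> k _; rewrite one2E Normc.normc0 mul0r.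
by rewrite one2E Normc.normc1 mul1r.
Qed.

Lemma wnormX rho n A m : 0 <= rho -> wnorm rho n (A ^+ m) <= wnorm rho n A ^+ m.
Proof.
move=> rho0; elim: m => [|m IH]; first by rewrite !expr0 wnorm1.
rewrite !exprS; apply: le_trans (wnormM _ _ _ rho0) _.
by apply: ler_wpM2l => //; exact: wnorm_ge0.
Qed.

Lemma wnorm_bar2 rho n A : wnorm rho n (bar2 A) = wnorm rho n A.
Proof.
rewrite /wnorm exchange_big; apply: eq_bigr => j _; apply: eq_bigr => k _.
by rewrite /bar2 normc_conj addnC.
Qed.

(** Expand the composition, bound each F^p (bar F)^q by eps^(p + q) and
recognize the weighted norm of A at radius eps. Degrees below n in both
indeterminates only involve powers p, q below 2n. *)
Lemma wnorm_comp2 rho eps n A F : 0 <= rho -> vanish 1 F ->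
  wnorm rho n F <= eps -> wnorm rho n (comp2 A F) <= wnorm eps (n + n) A.
Proof.
move=> rho0 F1 Feps; have b1 := vanish_bar2 F1.
apply: (@le_trans _ _ (\sum_(p < n + n) \sum_(q < n + n)
    normc (A p q) * wnorm rho n (F ^+ p * bar2 F ^+ q))).
  have -> : \sum_(p < n + n) \sum_(q < n + n)
        normc (A p q) * wnorm rho n (F ^+ p * bar2 F ^+ q) =
      \sum_(j < n) \sum_(k < n) \sum_(p < n + n) \sum_(q < n + n)
        normc (A p q) * (normc ((F ^+ p * bar2 F ^+ q) j k) * rho ^+ (j + k)).
    under eq_bigr do under eq_bigr do rewrite mulr_sumr.
    under eq_bigr do rewrite exchange_big.
    rewrite exchange_big; apply: eq_bigr => j _.
    under eq_bigr do under eq_bigr do rewrite mulr_sumr.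
    under eq_bigr do rewrite exchange_big.
    by rewrite exchange_big.
  apply: ler_sum => j _; apply: ler_sum => k _.
  rewrite comp2E (@sub2_coef R (n + n))//; last first.
    by have := ltn_ord j; have := ltn_ord k; lia.
  apply: le_trans (ler_wpM2r (exprn_ge0 _ rho0) (normc_sum _ _ _)) _.
  rewrite mulr_suml; apply: ler_sum => p _.
  apply: le_trans (ler_wpM2r (exprn_ge0 _ rho0) (normc_sum _ _ _)) _.
  rewrite mulr_suml; apply: ler_sum => q _.
  by rewrite Normc.normcM mulrA.
have w0 := wnorm_ge0 n F rho0.
apply: ler_sum => p _; apply: ler_sum => q _; apply: ler_wpM2l; first exact: normc_ge0.
apply: le_trans (wnormM _ _ _ rho0) _; rewrite exprD.
apply: ler_pM; [exact: wnorm_ge0|exact: wnorm_ge0| |].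
  by apply: le_trans (wnormX _ _ _ rho0) _; apply: lerXn2r; rewrite ?nnegrE// (le_trans w0).
apply: le_trans (wnormX _ _ _ rho0) _; rewrite wnorm_bar2.
by apply: lerXn2r; rewrite ?nnegrE// (le_trans w0).
Qed.

(** Every nonzero coefficient has positive degree, so its weight contains the
factor t at least once. *)
Lemma wnorm_contract rho t n F : 0 <= rho -> 0 <= t <= 1 -> F 0%N 0%N = 0 ->
  wnorm (t * rho) n F <= t * wnorm rho n F.
Proof.
move=> rho0 /andP[t0 t1] F0; rewrite /wnorm mulr_sumr; apply: ler_sum => j _.
rewrite mulr_sumr; apply: ler_sum => k _.
rewrite exprMn mulrCA; set x := _ * rho ^+ _.
have x0 : 0 <= x by rewrite mulr_ge0 ?normc_ge0 ?exprn_ge0.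
have [jk|jk] := posnP (j + k); last first.
  by apply: ler_wpM2r => //; case: (j + k)%N jk => // m _; rewrite exprS ler_piMr// exprn_ile1.
have [j0 k0] : (j = 0 :> nat) /\ (k = 0 :> nat) by lia.
by rewrite /x j0 k0 F0 Normc.normc0 !mul0r !mulr0.
Qed.

Definition square n : seq (nat * nat) :=
  [seq (j, k) | j <- iota 0 n, k <- iota 0 n].

Lemma square_uniq n : uniq (square n).
Proof. by apply: allpairs_uniq; rewrite ?iota_uniq// => -[a b] [c d]. Qed.

Lemma mem_square n (x : nat * nat) : (x \in square n) = ((x.1 < n) && (x.2 < n))%N.
Proof.
apply/allpairsP/andP => [[[a b] /=]|[x1 x2]].
  by rewrite !mem_iota/= !add0n => -[an bn ->].
by exists x; rewrite !mem_iota/= !add0n; split => //; case: x {x1 x2}.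
Qed.

Lemma sum_square n (f : nat -> nat -> R) :
  (\sum_(x \in [set` square n]) (f x.1 x.2)%:E =
   (\sum_(j < n) \sum_(k < n) f j k)%:E)%E.
Proof.
rewrite -fsbig_seq ?square_uniq// big_allpairs.
rewrite -(big_mkord xpredT (fun j => \sum_(k < n) f j k)) -sumEFin /index_iota subn0.
apply: eq_bigr => j _.
by rewrite -(big_mkord xpredT (f j)) -sumEFin /index_iota subn0.
Qed.

(** Every finite set of indices lies in a square, and the two radii may be
replaced by the smaller one. *)
Lemma convergent2P A : convergent2 A <->
  exists2 rho, 0 < rho & exists C, forall n, wnorm rho n A <= C.
Proof.
split=> [[rho1 [rho2 [r1 r2 Afin]]]|[rho rho0 [C AC]]]; last first.
  exists rho, rho; split=> //; apply: (@le_lt_trans _ _ C%:E); last by rewrite ltry.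
  apply: ge_ereal_sup => _ [X [Xfin _] <-].
  have [n Xn] : exists n, X `<=` [set` square n].
    have [s ->] := (finite_seqP X).1 Xfin.
    exists (\max_(x <- s) (x.1 + x.2).+1)%N => x /= xs.
    have := @leq_bigmax_seq _ s xpredT (fun x : nat * nat => (x.1 + x.2).+1) x xs isT.
    rewrite mem_square; set m := bigop _ _ _ => xm.
    by rewrite !(leq_trans _ xm)// ltnS ?leq_addr ?leq_addl.
  apply: (@le_trans _ _ (\sum_(x \in [set` square n])
      (normc (A x.1 x.2) * rho ^+ x.1 * rho ^+ x.2)%:E)%E).
    apply: lee_fsum_nneg_subset => //; first exact: finite_seq.
      by move=> x /set_mem/Xn/mem_set.
    by move=> x _; rewrite lee_fin !mulr_ge0 ?normc_ge0 ?exprn_ge0// ltW.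
  rewrite (sum_square n (fun j k => normc (A j k) * rho ^+ j * rho ^+ k)) lee_fin.
  apply: le_trans (AC n); rewrite le_eqVlt; apply/orP; left; apply/eqP.
  by apply: eq_bigr => j _; apply: eq_bigr => k _; rewrite exprD mulrA.
pose rho := Num.min rho1 rho2.
have rho0 : 0 < rho by rewrite lt_min r1.
exists rho => //; exists (fine (\esum_(jk in [set: nat * nat])
       (normc (A jk.1 jk.2) * rho1 ^+ jk.1 * rho2 ^+ jk.2)%:E)%E) => n.
rewrite -lee_fin fineK; last first.
  rewrite ge0_fin_numE//; apply: esum_ge0 => x _.
  by rewrite lee_fin !mulr_ge0 ?normc_ge0 ?exprn_ge0// ltW.
apply: esum_ge; exists [set` square n]; first by split => //; exact: finite_seq.
rewrite (sum_square n (fun j k => normc (A j k) * rho1 ^+ j * rho2 ^+ k)) lee_fin.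
apply: ler_sum => j _; apply: ler_sum => k _; rewrite exprD mulrA.
have le1 : rho ^+ j <= rho1 ^+ j.
  by apply: lerXn2r; rewrite ?nnegrE ?(ltW rho0) ?(ltW r1)// ge_min lexx.
have le2 : rho ^+ k <= rho2 ^+ k.
  by apply: lerXn2r; rewrite ?nnegrE ?(ltW rho0) ?(ltW r2)// ge_min lexx orbT.
apply: ler_pM => //; rewrite ?mulr_ge0 ?normc_ge0 ?exprn_ge0 ?(ltW rho0)//.
by apply: ler_wpM2l; rewrite ?normc_ge0.
Qed.

Lemma convergent2_comp2 A F : F 0%N 0%N = 0 ->
  convergent2 A -> convergent2 F -> convergent2 (comp2 A F).
Proof.
move=> F0 /convergent2P[eps eps0 [C AC]] /convergent2P[rho rho0 [D FD]].
have D0 : 0 <= D by apply: le_trans (FD 0%N); apply/wnorm_ge0/ltW.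
(* Shrink the radius of F until its norm is at most the radius eps of A; the
   summand 1 covers D = 0. *)
pose t := Num.min 1 (eps / (D + 1)).
have t0 : 0 < t by rewrite lt_min ltr01 divr_gt0//; lra.
apply/convergent2P; exists (t * rho); first by rewrite mulr_gt0.
exists C => n; apply: le_trans (AC (n + n)%N).
apply: wnorm_comp2; [by rewrite mulr_ge0 ?ltW|exact: vanish1|].
apply: le_trans (@wnorm_contract _ _ _ _ (ltW rho0) _ F0) _.
  by rewrite (ltW t0)/= /t ge_min lexx.
apply: le_trans (ler_wpM2l (ltW t0) (FD n)) _.
have : t <= eps / (D + 1) by rewrite /t ge_min lexx orbT.
rewrite ler_pdivlMr; last by lra.
by nra.
Qed.

End Convergence.

(** * Invariant foliations *)

Section Foliations.
Context {R : realType}.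
Implicit Types (F G L Psi : series2 R) (c : set (series2 R)) (omega : R).

Lemma fclass_refl L : vanish 1 L -> fclass L L.
Proof. by move=> L1; exists idG; rewrite ?comp1_id. Qed.

(** Both inclusions use that transition series form a group. *)
Lemma fclass_comp1 g L : setG g -> vanish 1 L -> vanish 1 (comp1 g L) ->
  fclass (comp1 g L) = fclass L.
Proof.
move=> gG L1 gL1; apply/seteqP; split=> _ [f fG ->].
  by have [k kG fg] := setG_comp fG gG; exists k; rewrite ?fg.
have [h hG hg] := setG_left_inverse gG.
have [k kG fh] := setG_comp fG hG.
by exists k => //; rewrite -fh// hg.
Qed.

Lemma foliation_comp_fclass L F : vanish 1 L -> vanish 1 F ->
  foliation_comp (fclass L) F = fclass (comp2 L F).
Proof.
move=> L1 F1; have LF1 := vanish_comp2 F1 L1; apply/seteqP; split.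
  move=> _ [_ [g gG ->] [f fG ->]]; rewrite comp1_comp2//.
  by have [k kG fg] := setG_comp fG gG; exists k; rewrite ?fg.
by move=> L' L'L; exists L => //; exact: fclass_refl.
Qed.

(** Two orbits are equal as soon as one contains an element of the other; so
invariance only says that L o F lies in the orbit of L. *)
Lemma invariant_fclassP F L : setF F -> setL L ->
  foliation_invariant F (fclass L) <-> admissible F L.
Proof.
move=> FF LL; have [F1 L1] := (setF_vanish FF, setL_vanish LL).
rewrite /foliation_invariant foliation_comp_fclass//; split=> [LF|[_ [g gG ->]]].
  split=> //; suff : fclass L (comp2 L F) by [].
  by rewrite -LF; exact/fclass_refl/vanish_comp2.
exact/fclass_comp1/setL_vanish/setL_comp1.
Qed.

Variable omega : R.
Hypothesis omega_irrational : irrational omega.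

Lemma setF_rot_setF F : setF_rot omega F -> setF F.
Proof. by move=> Fw; exists (expi2pi omega) => //; exact: norm_expi2pi. Qed.

Lemma admissible_fclass F L L' : setF_rot omega F ->
  admissible F L -> admissible F L' -> fclass L' = fclass L.
Proof.
move=> Fw FL FL'; have [g gG L'E] := admissible_orbit (norm_expi2pi omega)
  (fun n => @expi2pi_irrational R omega n omega_irrational) Fw FL FL'.
rewrite L'E; apply: fclass_comp1 => //; first exact: setL_vanish FL.1.
by rewrite -L'E; exact: setL_vanish FL'.1.
Qed.

Lemma invariant_foliation_unique F L c : setF_rot omega F -> admissible F L ->
  formal_foliation c /\ foliation_invariant F c <-> c = fclass L.
Proof.
move=> Fw FL; have FF := setF_rot_setF Fw; split.
  move=> [[L' LL' ->]] /(invariant_fclassP FF LL') FL'.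
  exact: admissible_fclass Fw FL FL'.
move=> ->; split; first by exists L => //; exact: FL.1.
by apply/invariant_fclassP => //; exact: FL.1.
Qed.

Lemma invariant_foliationE F L : setF_rot omega F -> admissible F L ->
  invariant_foliation F = fclass L.
Proof.
move=> Fw FL; apply/(invariant_foliation_unique _ Fw FL).
rewrite /invariant_foliation.
apply: (xgetPex set0 (P := [set c | formal_foliation c /\ foliation_invariant F c])).
by exists (fclass L); apply/(invariant_foliation_unique _ Fw FL).
Qed.

(** The multiplier of a composition is the product of the multipliers, so those of
Psi and of its inverse cancel. *)
Lemma setF_rot_conj2 F Psi : setF_rot omega F -> setF Psi ->
  setF_rot omega (conj2 Psi F).
Proof.
move=> Fw PsiF; have [[mu' _ iPsi] _ iPsiK] := inv2P PsiF.
have [mu _ Psimu] := PsiF.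
have mumu : mu' * mu = 1.
  by have [_] := has_linear_part_comp iPsi Psimu; rewrite iPsiK => <-.
have := has_linear_part_comp iPsi (has_linear_part_comp Fw Psimu).
by rewrite mulrCA mumu mulr1.
Qed.

(** (L o Psi) o (Psi^-1 o F o Psi) = (L o F) o Psi = g o (L o Psi). *)
Lemma admissible_conj2 F Psi L : setF F -> setF Psi -> admissible F L ->
  admissible (conj2 Psi F) (comp2 L Psi).
Proof.
move=> FF PsiF [LL [g gG LF]]; have [iF PsiK _] := inv2P PsiF.
have [F1 Psi1] := (setF_vanish FF, setF_vanish PsiF).
have [i1 L1] := (setF_vanish iF, setL_vanish LL).
split; first exact: setL_comp2.
have FPsi1 := setF_vanish (setF_comp FF PsiF).
have iFPsi1 := setF_vanish (setF_comp iF (setF_comp FF PsiF)).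
exists g => //; rewrite /conj2 comp2A// -(comp2A Psi i1 FPsi1) PsiK id2_comp//.
by rewrite -comp2A// LF comp1_comp2.
Qed.

(** nu o Phi o F = nu o (Phi o F o Phi^-1) o Phi = g o nu o Phi. *)
Lemma admissible_geometric_normalization F Phi : setF F ->
  geometric_normalization F Phi -> admissible F (comp2 nu Phi).
Proof.
move=> FF [/tangent_setF PhiF [g gG]]; have [iF PhiK iPhiK] := inv2P PhiF.
have [F1 Phi1] := (setF_vanish FF, setF_vanish PhiF); have i1 := setF_vanish iF.
have nuL := @setL_nu R; have nu1 := setL_vanish nuL.
have FiPhi1 := setF_vanish (setF_comp FF iF).
have G1 := setF_vanish (setF_comp PhiF (setF_comp FF iF)).
move=> nuG; split; first exact: setL_comp2.
exists g => //; rewrite -comp1_comp2// -nuG !comp2A// iPhiK comp2_id.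
by [].
Qed.

End Foliations.

Theorem proposition2p7 (R : realType) (omega : R) (F : series2 R) :
  irrational omega ->
  setF_rot omega F ->
  (exists! c : set (series2 R), formal_foliation c /\ foliation_invariant F c) /\
  (forall L : series2 R, admissible F L -> invariant_foliation F = fclass L) /\
  (forall Phi : series2 R, geometric_normalization F Phi ->
     invariant_foliation F = foliation_comp (fclass nu) Phi) /\
  (forall Psi : series2 R, setF Psi ->
     setF_rot omega (conj2 Psi F) /\
     invariant_foliation (conj2 Psi F) =
       foliation_comp (invariant_foliation F) Psi) /\
  (analytic_foliation (invariant_foliation F) ->
   forall Psi : series2 R, setF Psi -> convergent2 Psi ->
     analytic_foliation (invariant_foliation (conj2 Psi F))).
Proof.
move=> irr Fw; have FF := setF_rot_setF Fw.
have [L FL] := admissible_exists (norm_expi2pi omega)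
  (fun n => @expi2pi_irrational R omega n irr) Fw.
have L1 := setL_vanish FL.1.
have conjE Psi : setF Psi -> invariant_foliation (conj2 Psi F) =
    foliation_comp (invariant_foliation F) Psi.
  move=> PsiF; have Psi1 := setF_vanish PsiF.
  rewrite (invariant_foliationE irr Fw FL) foliation_comp_fclass//.
  by apply: (invariant_foliationE irr (setF_rot_conj2 Fw PsiF)); exact: admissible_conj2.
split; [|split; [|split; [|split]]].
- exists (fclass L); split; first exact/(invariant_foliation_unique irr _ Fw FL).
  by move=> c /(invariant_foliation_unique irr _ Fw FL).
- by move=> L1' FL1; apply: (invariant_foliationE irr Fw FL1).
- move=> Phi Phin; have [/tangent_setF/setF_vanish Phi1 _] := Phin.
  rewrite foliation_comp_fclass//; last exact/setL_vanish/setL_nu.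
  by apply: (invariant_foliationE irr Fw); exact: admissible_geometric_normalization.
- by move=> Psi PsiF; split; [exact: setF_rot_conj2|exact: conjE].
move=> [L' FL' L'conv] Psi PsiF Psiconv; rewrite conjE//.
have Psi1 := setF_vanish PsiF.
exists (comp2 L' Psi); last by apply: convergent2_comp2 => //; exact: Psi1.
exists L' => //; apply/fclass_refl/vanish_comp2 => //.
move: FL'; rewrite (invariant_foliationE irr Fw FL) => -[g gG ->].
exact/setL_vanish/setL_comp1/FL.1.
Qed.
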